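(* Let $m,N\ge1$ and let $\xi_1,\dots,\xi_m$ be mutually independent random variables with $\xi_i\sim GH_1(\lambda_i,\chi_i,\psi_i,0,1,\varphi_i)$, where each $(\lambda_i,\chi_i,\psi_i)$ is admissible and $\varphi_i\in\mathbb{R}$. Let $r_i>0$ ($i=1,\dots,m$). Assume that for each $i$ one of the following holds: \begin{itemize} \item $\psi_i>0$; \item $\psi_i=0$ and $\varphi_i<0$; \item $\psi_i=0$, $\varphi_i>0$, and $r_i<-\lambda_i$; \item $\psi_i=0$, $\varphi_i=0$, $\lambda_i<0$, and $r_i<-2\lambda_i$. \end{itemize} Suppose that each $g_i$ is $(-r_i)$-concave on a convex set $X\subset\mathbb{R}^N$. Then the density of each $\xi_i$ is $(r_i+1)$-decreasing, and the set $$M(p):=\left\{x\in X:\ \prod_{i=1}^m\mathbb{P}(\xi_i\le g_i(x))\ge p\right\}$$ is convex for all $p>\max_{1\le i\le m}F_{\xi_i}(t_i^* )$, where $F_{\xi_i}$ is the distribution function of $\xi_i$ and $t_i^*>0$ denotes a threshold associated with the $(r_i+1)$-decreasing density of $\xi_i$.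
   Context: A function $f:\mathbb{R}\to\mathbb{R}$ is called $\alpha$-decreasing, for $\alpha\in\mathbb{R}$, if $f$ is continuous on $(0,+\infty)$ and there exists $t^*>0$ (a threshold) such that $t\mapsto t^\alpha f(t)$ is strictly decreasing on $(t^*,+\infty)$. A function $f:\Omega\to[0,+\infty)$ on a set $\Omega\subset\mathbb{R}^N$ is $\alpha$-concave, $\alpha\in[-\infty,+\infty]$, if $f(\lambda x+(1-\lambda)y)\ge m_\alpha(f(x),f(y),\lambda)$ for all $x,y\in\Omega$, $\lambda\in[0,1]$, where $m_\alpha(a,b,\lambda)=0$ if $ab=0$, and for $a,b>0$: $m_0(a,b,\lambda)=a^\lambda b^{1-\lambda}$, $m_{+\infty}=\max\{a,b\}$, $m_{-\infty}=\min\{a,b\}$, and $m_\alpha(a,b,\lambda)=(\lambda a^\alpha+(1-\lambda)b^\alpha)^{1/\alpha}$ otherwise. In particular $(-r_i)$-concave functions take values in $[0,+\infty)$. $K_\nu$ ($\nu\in\mathbb{R}$) denotes the modified Bessel function of the third kind (also called of the second kind), $K_\nu(x)=\frac12\int_0^\infty u^{\nu-1}e^{-\frac{x}{2}(u+u^{-1})}\,du$, $x>0$. The triple $(\lambda,\chi,\psi)$ is admissible if: $\chi>0,\psi\ge0$ when $\lambda<0$; $\chi>0,\psi>0$ when $\lambda=0$; $\chi\ge0,\psi>0$ when $\lambda>0$. The generalized inverse Gaussian distribution $Gig(\lambda,\chi,\psi)$ has density on $(0,\infty)$ $$h(t)=\frac{\chi^{-\lambda}(\sqrt{\chi\psi})^{\lambda}}{2K_\lambda(\sqrt{\chi\psi})}\,t^{\lambda-1}\exp\!\left(-\tfrac12(\chi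 t^{-1}+\psi t)\right)$$ if $\chi,\psi>0$; for $\psi=0$ (so $\lambda<0,\chi>0$) it is the inverse gamma distribution with density $\left(\frac{\chi}{2}\right)^{-\lambda}\Gamma(-\lambda)^{-1}t^{\lambda-1}e^{-\chi/(2t)}$; for $\chi=0$ (so $\lambda>0,\psi>0$) it is the gamma distribution with density $\frac{(\psi/2)^\lambda}{\Gamma(\lambda)}t^{\lambda-1}e^{-\psi t/2}$. $GH_1(\lambda,\chi,\psi,\mu,\sigma^2,\varphi)$ ($\sigma>0$) is the law of $\mu+W\varphi+\sqrt{W}\,\sigma Z$ with $Z\sim\mathcal N(0,1)$ and $W\sim Gig(\lambda,\chi,\psi)$ independent. The density of $GH_1(\lambda,\chi,\psi,0,1,\varphi)$ is $f_\xi(t)=\int_0^\infty(2\pi\omega)^{-1/2}\exp\left(\varphi t-\frac{t^2}{2\omega}-\frac{\varphi^2\omega}{2}\right)h(\omega)\,d\omega$, where $h$ is the density of $W$. *)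

(* Defs.v *)
From HB Require Import structures.
From mathcomp Require Import all_boot all_order all_algebra.
From mathcomp Require Import all_classical all_reals all_analysis.

Set Implicit Arguments.
Unset Strict Implicit.
Unset Printing Implicit Defensive.

Import Order.TTheory GRing.Theory Num.Theory.
Import numFieldNormedType.Exports.

Local Open Scope classical_set_scope.
Local Open Scope ring_scope.

Definition is_threshold (R : realType) (alpha : R) (f : R -> R) (tstar : R) :=
  0 < tstar /\
  forall s t : R, tstar < s -> s < t -> t `^ alpha * f t < s `^ alpha * f s.

Definition alpha_decreasing (R : realType) (alpha : R) (f : R -> R) :=
  {in `]0, +oo[, continuous f} /\ exists tstar, is_threshold alpha f tstar.

Definition mean_alpha (R : realType) (alpha : \bar R) (a b l : R) : R :=
  if a * b == 0 then 0 else
  match alpha with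
  | +oo%E => Num.max a b
  | -oo%E => Num.min a b
  | r%:E => if r == 0 then a `^ l * b `^ (1 - l)
            else (l * a `^ r + (1 - l) * b `^ r) `^ r^-1
  end.

(* Taking values in [0, +oo[ on the domain is part of alpha-concavity. *)
Definition alpha_concave (R : realType) (N : nat) (alpha : \bar R)
    (Omega : set 'rV[R]_N) (f : 'rV[R]_N -> R) :=
  (forall x, Omega x -> 0 <= f x) /\
  forall x y (l : R), Omega x -> Omega y -> 0 <= l <= 1 ->
    mean_alpha alpha (f x) (f y) l <= f (l *: x + (1 - l) *: y).

Definition besselK (R : realType) (nu x : R) : R :=
  2^-1 * \int[lebesgue_measure]_(u in `]0, +oo[)
           (u `^ (nu - 1) * expR (- (x / 2) * (u + u^-1))).

Definition gamma_fun (R : realType) (z : R) : R :=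
  \int[lebesgue_measure]_(u in `]0, +oo[) (u `^ (z - 1) * expR (- u)).

Definition gig_admissible (R : realType) (lambda chi psi : R) :=
  [\/ [/\ lambda < 0, 0 < chi & 0 <= psi],
      [/\ lambda = 0, 0 < chi & 0 < psi] |
      [/\ 0 < lambda, 0 <= chi & 0 < psi]].

(* Meaningful for admissible parameters only; chi and psi do not both vanish. *)
Definition gig_pdf (R : realType) (lambda chi psi t : R) : R :=
  if t <= 0 then 0
  else if psi == 0 then
    (chi / 2) `^ (- lambda) / gamma_fun (- lambda) *
    t `^ (lambda - 1) * expR (- (chi / (2 * t)))
  else if chi == 0 then
    (psi / 2) `^ lambda / gamma_fun lambda *
    t `^ (lambda - 1) * expR (- (psi * t / 2))
  else
    chi `^ (- lambda) * Num.sqrt (chi * psi) `^ lambda /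
    (2 * besselK lambda (Num.sqrt (chi * psi))) *
    t `^ (lambda - 1) * expR (- 2^-1 * (chi * t^-1 + psi * t)).

Definition gig_law (R : realType) (lambda chi psi : R) : set R -> \bar R :=
  fun A => (\int[lebesgue_measure]_(t in A) (gig_pdf lambda chi psi t)%:E)%E.

(* Law of mu + W phi + sqrt W sigma Z with (W, Z) distributed as the product
   of Gig(lambda, chi, psi) and N(0, 1), i.e. W and Z are independent. *)
Definition gh_law (R : realType) (lambda chi psi mu sigma2 phi : R) :
    set R -> \bar R :=
  pushforward (gig_law lambda chi psi \x normal_prob 0 1)%E
    (fun wz : R * R =>
       mu + wz.1 * phi + Num.sqrt wz.1 * Num.sqrt sigma2 * wz.2).

(* Real-valued integral: at t = 0, where the density may be infinite, the value
   is then 0. *)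
Definition gh_density (R : realType) (lambda chi psi phi t : R) : R :=
  \int[lebesgue_measure]_(w in `]0, +oo[)
    ((2 * pi * w) `^ (- 2^-1) *
     expR (phi * t - t ^+ 2 / (2 * w) - phi ^+ 2 * w / 2) *
     gig_pdf lambda chi psi w).

Section random_variables.
Context {R : realType} {d : measure_display} {T : measurableType d}.
Variable P : probability T R.

Definition has_law (X : {RV P >-> R}) (nu : set R -> \bar R) :=
  forall A : set R, measurable A -> distribution P X A = nu A.

Definition has_density (X : {RV P >-> R}) (f : R -> R) :=
  [/\ measurable_fun [set: R] f, forall t, 0 <= f t &
      has_law X (fun A => \int[lebesgue_measure]_(t in A) (f t)%:E)%E].

Definition mutually_independent (m : nat) (xi : 'I_m -> {RV P >-> R}) :=
  forall (J : {set 'I_m}) (A : 'I_m -> set R),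
    (forall i, i \in J -> measurable (A i)) ->
    P (\bigcap_(i in [set` J]) (xi i @^-1` A i)) =
    (\prod_(i in J) P (xi i @^-1` A i))%E.

Definition prob_set (m N : nat) (X : set 'rV[R]_N) (xi : 'I_m -> {RV P >-> R})
    (g : 'I_m -> 'rV[R]_N -> R) (p : R) : set 'rV[R]_N :=
  [set x | X x /\
    (p%:E <= \prod_(i < m) P [set w | (xi i w <= g i x)%R])%E].

End random_variables.

(* Main.v *)
Require Import Defs.
From HB Require Import structures.
From mathcomp Require Import all_boot all_order all_algebra.
From mathcomp Require Import all_classical all_reals all_analysis.
From mathcomp Require Import measurable_realfun ring lra.
Set Implicit Arguments.
Unset Strict Implicit.
Unset Printing Implicit Defensive.
Import Order.TTheory GRing.Theory Num.Theory.
Import numFieldNormedType.Exports.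
Local Open Scope classical_set_scope.
Local Open Scope ring_scope.

(** The law [gh_law] is that of [W phi + sqrt W Z], so that given [W = w] it is
    normal with mean [w phi] and variance [w].

    Density.  By Tonelli the law has density [f t], the integral over [w] of the
    normal density [drift_kernel phi w t] against the density of [W]
    ([mixture_lawE]).  Uniformly in [w] that normal density is at most
    [expR (phi t) / `|t|] ([drift_kernel_le]), so [f] is finite away from [0]
    and, by dominated convergence, continuous on the positive half-line.  The
    normalising constant of the density of [W] is nonnegative by its form, and
    positive because the law has mass one.

    Threshold.  Collecting exponents, for [t > 0],
      $f(t) = C e^{\varphi t} I(u)$, $u = \sqrt{t^2 + \chi}$,
      $I(u) = \int_0^\infty w^{\nu - 1} e^{-(u^2 / w + b w) / 2} dw$,
      $\nu = \lambda - 1/2$, $b = \varphi^2 + \psi$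
    ([gh_density_bessel]); $I$ is a Bessel function up to elementary factors.
    It remains to see that $t^{r + 1} e^{\varphi t} I(u)$ eventually decreases.
    In each case a change of variable in $I$ makes this visible pointwise, under
    the integral sign.
    - If $\varphi < \sqrt b$ (that is, $\psi > 0$ or $\varphi < 0$), put
      $w = u v$: the integrand becomes a power of $t$ and $u$ times
      $\exp(\varphi t - u (1 / v + b v) / 2)$, where
      $(1 / v + b v) / 2 \ge \sqrt b$, and it decreases in [t] for every [v],
      from a threshold that is the same for all [v]
      ([bessel_integral_decreasing_lt]).
    - If $b = 0$, put $w = u^2 v$: then $I(u)$ is $u^{2 \nu}$ times a constant,
      and $r + 1 < 1 - 2 \lambda = - 2 \nu$ ([bessel_integral_decreasing0]).
    - If $b = \varphi^2$ with $\varphi > 0$, the two exponentials cancel to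
      leading order and the next order of $I$ decides.  Put
      $y = (\varphi w - u) / \sqrt w$: the exponent becomes
      $- \varphi u - y^2 / 2$, and after symmetrisation in [y] the integral is,
      up to a constant factor, $u^{\nu - 1/2} e^{- \varphi u}$ times
      $\int e^{- y^2 / 2} \cosh(2 \nu a) / \cosh(a) dy$, where
      $a = \operatorname{asinh}(y / (2 \sqrt{\varphi u}))$
      ([bessel_integral_asinh]).  The last integrand decreases with [u], because
      $\cosh(k a) / \cosh(a)$ increases with $a \ge 0$ when $k \ge 1$
      ([dcosh_ratio_le]), and what is left is
      $t^{r + 1} u^{\lambda - 1} e^{\varphi (t - u)}$, which eventually
      decreases because $r + 1 < 1 - \lambda$ ([power_radius_decreasing]).

    Convexity.  Let $F$ be the distribution function of a variable whose density
    $f$ is such that $s^{r + 1} f(s)$ decreases beyond a threshold.  Comparing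
    $f$ with $s^{- r - 1}$ on the two sides of a point shows that
    $F(\tau^{-1/r})$ is concave in $\tau$ there, that is, $F$ at a mean of
    exponent [- r] is at least the average of $F$ ([cdf_concave]).  If [x] is in
    the set, every factor of its product is at least [p], hence larger than the
    distribution function at the threshold, so every [g i x] lies beyond the
    threshold.  At a convex combination of two points of the set, every factor
    is therefore at least the average of the factors at these points, and a
    product of averages is at least the weighted geometric mean of the products,
    hence at least [p] ([prod_conv_ge], [convex_prob_set]). *)

(** * Measurability, densities and affine changes of variable *)

(** Writing $x^{-1} = x (x^2)^{-1}$ expresses the inverse, which is discontinuous
    at [0], through a measurable real power. *)
Lemma measurable_invr (R : realType) : measurable_fun [set: R] (@GRing.inv R).
Proof.
rewrite (_ : @GRing.inv R = (fun x : R => x * (x ^+ 2) `^ (-1))).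
  apply: measurable_funM => //.
  by apply: (@measurableT_comp _ _ _ _ _ _ (@powR R ^~ (-1))).
apply/funext => x; rewrite powR_inv1 ?sqr_ge0//.
have [->|x0] := eqVneq x 0; first by rewrite invr0 mul0r.
by rewrite expr2 invfM mulrA divff// mul1r.
Qed.

Section density.
Local Open Scope ereal_scope.
Context d (T : measurableType d) (R : realType).
Variables (mu nu : {measure set T -> \bar R}) (h : T -> R).
Hypotheses (mh : measurable_fun [set: T] h) (h0 : forall x, (0 <= h x)%R).
Hypothesis nuE : forall A, measurable A -> nu A = \int[mu]_(x in A) (h x)%:E.

Import HBNNSimple.

(** Both sides are monotone limits of their values at simple functions, where
    the hypothesis on [nu] applies to every level set. *)
Lemma ge0_integral_density (f : T -> \bar R) :
  measurable_fun [set: T] f -> (forall x, 0 <= f x) ->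
  \int[nu]_x f x = \int[mu]_x (f x * (h x)%:E).
Proof.
move=> mf f0.
pose f_ := nnsfun_approx measurableT mf.
have mfh n : measurable_fun [set: T] (fun x => (f_ n x)%:E * (h x)%:E).
  by apply: emeasurable_funM; exact/measurable_EFinP.
transitivity (limn (fun n => \int[nu]_x (f_ n x)%:E)).
  rewrite -monotone_convergence//=.
  - apply: eq_integral => x _; apply/esym/cvg_lim => //=.
    exact: cvg_nnsfun_approx.
  - by move=> n; exact/measurable_EFinP.
  - by move=> n x _; rewrite lee_fin.
  - by move=> x _ m n mn; rewrite lee_fin; exact/lefP/nd_nnsfun_approx.
transitivity (limn (fun n => \int[mu]_x ((f_ n x)%:E * (h x)%:E))); last first.
  rewrite -monotone_convergence//=.
  - apply: eq_integral => x _.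
    have [hx0|hx0] := eqVneq (h x) 0%R.
      rewrite hx0 mule0; apply/cvg_lim => //.
      by under eq_fun do rewrite mule0; exact: cvg_cst.
    apply/cvg_lim => //; apply: cvgeZr => //.
    exact: cvg_nnsfun_approx.
  - by move=> n x _; rewrite mule_ge0// lee_fin.
  - move=> x _ m n mn; rewrite lee_wpmul2r ?lee_fin//.
    exact/lefP/nd_nnsfun_approx.
apply: congr_lim; apply/funext => n.
under eq_integral do rewrite fimfunE -fsumEFin//.
rewrite ge0_integral_fsum//; last 2 first.
- by move=> y; exact/measurable_EFinP/measurable_funM.
- by move=> y x _; rewrite EFinM nnfun_muleindic_ge0.
under [RHS]eq_integral.
  move=> x _; rewrite fimfunE -fsumEFin// ge0_mule_fsuml; last first.
    by move=> r; rewrite EFinM nnfun_muleindic_ge0.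
  over.
rewrite [RHS]ge0_integral_fsum//; last 2 first.
- move=> y; apply: emeasurable_funM; last exact/measurable_EFinP.
  exact/measurable_EFinP/measurable_funM.
- move=> y x _; rewrite mule_ge0 ?lee_fin// -lee_fin EFinM.
  exact: nnfun_muleindic_ge0.
apply: eq_fsbigr => r _.
rewrite integralZl_indic_nnsfun// integral_indic// setIT nuE//.
have mr : measurable (f_ n @^-1` [set r]) by [].
have [r0|r0] := leP 0%R r.
  transitivity (\int[mu]_x (r%:E * (\1_(f_ n @^-1` [set r]) x * h x)%:E)).
    rewrite ge0_integralZl//.
    - congr (_ * _); rewrite integral_mkcond; apply: eq_integral => x _.
      by rewrite patchE indicE; case: (x \in _); rewrite ?mul1r ?mul0r.
    - by apply/measurable_EFinP; apply: measurable_funM.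
    - by move=> x _; rewrite lee_fin mulr_ge0.
  by apply: eq_integral => x _; rewrite -!EFinM mulrA.
rewrite preimage_nnfun0//; rewrite integral_set0 mule0 integral0_eq// => x _.
by rewrite indic0 mulr0 mul0e.
Qed.

End density.

Section affine.
Local Open Scope ereal_scope.
Context (R : realType).
Notation mu := (@lebesgue_measure R).

(** The image of the Lebesgue measure under [x |-> a + c x], scaled by [c],
    gives intervals their length, hence is the Lebesgue measure. *)
Lemma ge0_integral_affine (a c : R) (f : R -> \bar R) : (0 < c)%R ->
  measurable_fun [set: R] f -> (forall x, 0 <= f x) ->
  \int[mu]_x f x = c%:E * \int[mu]_x f (a + c * x)%R.
Proof.
move=> c0 mf f0.
pose phi : measurableTypeR R -> measurableTypeR R := fun x => (a + c * x)%R.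
have mphi : measurable_fun [set: measurableTypeR R] phi.
  suff : measurable_fun [set: R] (fun x : R => (a + c * x)%R) by [].
  by apply: measurable_funD => //; exact: measurable_funM.
pose c' := NngNum (ltW c0).
have muE A : measurable A -> mu A = mscale c' (pushforward mu phi) A.
  apply: lebesgue_measure_unique => //= _ [[x y]] _ <-.
  rewrite /mscale/= /pushforward.
  have -> : phi @^-1` `]x, y] = `]((x - a) / c)%R, ((y - a) / c)%R]%classic.
    apply/seteqP; split => z /=; rewrite !in_itv/= ltr_pdivrMr// ler_pdivlMr//;
      rewrite ltrBlDl lerBrDl /phi [(z * c)%R]mulrC//.
  rewrite !lebesgue_measure_itv/= !lte_fin ltr_pM2r ?invr_gt0// ltrD2r.
  case: ifPn => xy; last by rewrite mule0.
  rewrite -!EFinB -EFinM; congr EFin; field; exact: lt0r_neq0.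
rewrite (@eq_measure_integral _ _ _ _ (mscale c' (pushforward mu phi))).
  by rewrite ge0_integral_mscale//= ge0_integral_pushforward.
by move=> A mA _; exact: muE.
Qed.

End affine.

(** * Strict comparison of integrals and substitution onto the half-line *)

Section positive_integrals.
Local Open Scope ereal_scope.
Context (R : realType).
Notation mu := (@lebesgue_measure R).

(** A vanishing integral would make [f] vanish almost everywhere on a set of
    infinite measure. *)
Lemma integral_itv0y_gt0 (f : R -> R) :
  measurable_fun (`]0%R, +oo[ : set R) f -> (forall x, 0 < x -> 0 < f x)%R ->
  0 < \int[mu]_(x in `]0%R, +oo[) (f x)%:E.
Proof.
move=> mf f0.
have f0' x : `]0%R, +oo[%classic x -> (0 < f x)%R.
  by rewrite /= in_itv/= andbT; exact: f0.
rewrite lt0e integral_ge0 ?andbT => [|x /f0' fx]; last by rewrite lee_fin ltW.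
apply/eqP => int0.
have : \int[mu]_(x in `]0%R, +oo[) `|(f x)%:E| = 0.
  rewrite -int0; apply: eq_integral => x /[!inE] /f0' fx.
  by rewrite gee0_abs// lee_fin ltW.
move/(ae_eq_integral_abs mu (measurable_itv _)) => -[|N [mN N0 sub]].
  exact/measurable_EFinP.
have : mu `]0%R, +oo[%classic <= mu N.
  apply: le_measure; rewrite ?inE// => x x0; apply: sub => /= /(_ x0).
  by move=> /eqP; rewrite eqe gt_eqF// f0'.
by rewrite N0 lebesgue_measure_itv/= ltry leye_eq.
Qed.

Lemma lt_integral_itv0y (f g : R -> R) :
  measurable_fun (`]0%R, +oo[ : set R) f ->
  measurable_fun (`]0%R, +oo[ : set R) g ->
  (forall x, 0 < x -> 0 <= f x)%R -> (forall x, 0 < x -> f x < g x)%R ->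
  \int[mu]_(x in `]0%R, +oo[) (f x)%:E < +oo ->
  \int[mu]_(x in `]0%R, +oo[) (f x)%:E < \int[mu]_(x in `]0%R, +oo[) (g x)%:E.
Proof.
move=> mf mg f0 fg fy.
have pos x : `]0%R, +oo[%classic x -> (0 < x)%R by rewrite /= in_itv/= andbT.
have -> : \int[mu]_(x in `]0%R, +oo[) (g x)%:E =
    \int[mu]_(x in `]0%R, +oo[) (f x)%:E +
    \int[mu]_(x in `]0%R, +oo[) (g x - f x)%:E.
  rewrite -ge0_integralD//.
  - by apply: eq_integral => x _; rewrite -EFinD subrKC.
  - by move=> x /pos x0; rewrite lee_fin f0.
  - exact/measurable_EFinP.
  - by move=> x /pos x0; rewrite lee_fin subr_ge0 ltW// fg.
  - by apply/measurable_EFinP; exact: measurable_funB.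
rewrite -[X in X < _]adde0 lteD2lE//.
  rewrite integral_itv0y_gt0//; first exact: measurable_funB.
  by move=> x x0; rewrite subr_gt0 fg.
rewrite ge0_fin_numE//; apply: integral_ge0 => x /pos x0.
by rewrite lee_fin f0.
Qed.

End positive_integrals.

Section substitution.
Local Open Scope ereal_scope.
Context (R : realType).
Notation mu := (@lebesgue_measure R).

(** The substitution is made on the compact intervals [[- n, n]], where bounded
    derivatives come for free, and extended by monotone convergence: [F] may
    thus have an unbounded derivative and tend to the excluded end point [0]. *)
Lemma ge0_integration_by_substitution_itv0y (F G : R -> R) :
  {homo F : x y / (x < y)%R} -> (forall x, derivable F x 1) ->
  continuous (derive1 F) -> (forall x, 0 < F x)%R ->
  (forall y, 0 < y -> exists x, F x = y)%R ->
  {in `]0%R, +oo[, continuous G} -> (forall y, 0 < y -> 0 <= G y)%R ->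
  \int[mu]_(y in `]0%R, +oo[) (G y)%:E =
  \int[mu]_x (((G \o F) * derive1 F) x)%:E.
Proof.
move=> incF dF cF' F0 surjF cG G0.
have cF : continuous F.
  by move=> x; exact/differentiable_continuous/derivable1_diffP/dF.
have leF : {homo F : x y / (x <= y)%R} by exact: ltW_homo.
have leF' : {mono F : x y / (x <= y)%R} by exact: le_mono.
have F'0 x : (0 <= derive1 F x)%R.
  apply: (@incr_derive1_ge0 _ _ setT) => //.
  - by move=> ? ? _ _; exact: incF.
  - by rewrite interiorT.
pose I n := `[F (- n%:R)%R, F n%:R]%classic.
pose J n := `[(- n%:R)%R, n%:R]%classic : set R.
have sumI : `]0%R, +oo[%classic = \bigcup_n I n.
  apply/seteqP; split => [y|y [n _]]; rewrite /I /= !in_itv/= ?andbT.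
    move=> /surjF[x <-]; exists (Num.truncn `|x|).+1 => //=.
    rewrite /I /= in_itv/= !leF' -ler_norml ltW//.
    by rewrite truncnS_gt.
  by move=> /andP[+ _]; exact: lt_le_trans.
have sumJ : [set: R] = \bigcup_n J n.
  apply/esym; rewrite -subTset => x _; exists (Num.truncn `|x|).+1 => //=.
  by rewrite /J /= in_itv/= -ler_norml ltW// truncnS_gt.
have mJ : {homo J : n m / (n <= m)%N >-> (n <= m)%O}.
  move=> n m nm; rewrite subsetEset => x; rewrite /J /= !in_itv/=.
  move=> /andP[nx xn]; rewrite (le_trans _ nx) ?lerN2 ?ler_nat//=.
  by rewrite (le_trans xn)// ler_nat.
have mI : {homo I : n m / (n <= m)%N >-> (n <= m)%O}.
  move=> n m nm; rewrite subsetEset => x; rewrite /I /= !in_itv/=.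
  move=> /andP[nx xn]; rewrite (le_trans _ nx) ?leF' ?lerN2 ?ler_nat//=.
  by rewrite (le_trans xn)// leF' ler_nat.
have mG : measurable_fun (`]0%R, +oo[ : set R) G.
  by apply: open_continuous_measurable_fun => // x /[!inE] x0; exact: cG.
have cGF : continuous (G \o F).
  move=> x; apply: continuous_comp; first exact: cF.
  by apply: cG; rewrite in_itv/= F0.
have mR : measurable_fun [set: R] ((G \o F) * derive1 F)%R.
  apply: measurable_funM; first exact: continuous_measurable_fun.
  exact: continuous_measurable_fun.
have IJ n : \int[mu]_(y in I n) (G y)%:E =
    \int[mu]_(x in J n) (((G \o F) * derive1 F) x)%:E.
  apply: integration_by_substitution_increasing => //.
  - by rewrite (@le_trans _ _ 0%R)// oppr_le0.
  - by move=> x y _ _; exact: incF.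
  - by apply/cvg_ex; eexists; exact/cvg_at_right_filter/cF'.
  - by apply/cvg_ex; eexists; exact/cvg_at_left_filter/cF'.
  - split=> [x _|//|//]; first exact: dF.
      exact/cvg_at_right_filter/cF.
    exact/cvg_at_left_filter/cF.
  - apply: continuous_in_subspaceT => x /[!inE]/=; rewrite in_itv/=.
    by move=> /andP[x0 _]; apply: cG; rewrite in_itv/= andbT (lt_le_trans _ x0).
have H1 := @ge0_nondecreasing_set_cvg_integral _ (measurableTypeR R) R I
  (EFin \o G) mu mI.
have H2 := @ge0_nondecreasing_set_cvg_integral _ (measurableTypeR R) R J
  (EFin \o ((G \o F) * derive1 F)%R) mu mJ.
rewrite sumI sumJ; apply/esym; rewrite -(cvg_lim _ (H2 _ _ _))//; last 3 first.
- by move=> i; exact: measurable_itv.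
- by move=> i; apply/measurable_EFinP; exact: measurable_funTS.
- by move=> i x _; rewrite lee_fin mulr_ge0//; exact: G0.
rewrite -(cvg_lim _ (H1 _ _ _))//; last 3 first.
- by move=> i; exact: measurable_itv.
- move=> i; apply/measurable_EFinP; apply: measurable_funS mG => //.
  by rewrite sumI; exact: bigcup_sup.
- move=> i x Ix; rewrite lee_fin G0//.
  suff : `]0%R, +oo[%classic x by rewrite /= in_itv/= andbT.
  by rewrite sumI; exists i.
by apply: congr_lim; apply/funext => n; rewrite IJ.
Qed.

End substitution.

(** * Eventually decreasing products of powers and exponentials *)

Lemma powR_expR_ln (R : realType) (x a : R) : 0 < x -> x `^ a = expR (a * ln x).
Proof. by move=> x0; rewrite /powR gt_eqF. Qed.

Lemma ln_le_sub1 (R : realType) (x : R) : 0 < x -> ln x <= x - 1.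
Proof.
move=> x0; rewrite -ler_expR lnK ?posrE//.
by rewrite (le_trans _ (expR_ge1Dx _))// addrC subrK.
Qed.

Lemma ln_sub_le (R : realType) (x y : R) : 0 < x -> 0 < y ->
  ln y - ln x <= (y - x) / x.
Proof.
move=> x0 y0; rewrite -ln_div ?posrE// (le_trans (ln_le_sub1 _)) ?divr_gt0//.
by rewrite mulrBl divff// gt_eqF.
Qed.

Section radius.
Context (R : realType).
Implicit Types chi t s : R.

(** The radius $u = \sqrt{t^2 + \chi}$ through which the density depends on [t]
    once the exponents are collected. *)
Definition radius chi t : R := Num.sqrt (t ^+ 2 + chi).

Lemma radius_sqr chi t : 0 <= chi -> radius chi t ^+ 2 = t ^+ 2 + chi.
Proof. by move=> chi0; rewrite sqr_sqrtr// addr_ge0// sqr_ge0. Qed.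

Lemma radius_ge chi t : 0 <= chi -> 0 < t -> t <= radius chi t.
Proof.
move=> chi0 t0; rewrite -(@ler_pXn2r _ 2)// ?nnegrE ?sqrtr_ge0 ?(ltW t0)//.
by rewrite radius_sqr// lerDl.
Qed.

Lemma radius_gt0 chi t : 0 <= chi -> 0 < t -> 0 < radius chi t.
Proof. by move=> chi0 t0; exact: lt_le_trans (radius_ge chi0 t0). Qed.

End radius.

Section radius_variation.
Context (R : realType).
Variables (chi t s : R).
Hypotheses (chi0 : 0 <= chi) (t0 : 0 < t) (ts : t < s).
Let u := radius chi t.
Let v := radius chi s.
Let s0 : 0 < s. Proof. exact: lt_trans ts. Qed.
Let u0 : 0 < u := radius_gt0 chi0 t0.
Let v0 : 0 < v := radius_gt0 chi0 s0.
Let uE : u ^+ 2 = t ^+ 2 + chi := radius_sqr t chi0.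
Let vE : v ^+ 2 = s ^+ 2 + chi := radius_sqr s chi0.
Let tu : t <= u := radius_ge chi0 t0.
Let sv : s <= v := radius_ge chi0 s0.

Lemma radius_lt : u < v.
Proof.
rewrite -(@ltr_pXn2r _ 2)// ?nnegrE ?ltW// uE vE ltrD2r.
by rewrite ltr_pXn2r// ?nnegrE ltW.
Qed.

Lemma radius_ratio : t * v <= s * u.
Proof.
rewrite -(@ler_pXn2r _ 2)// ?nnegrE; [|by rewrite mulr_ge0 ?ltW..].
rewrite !exprMn uE vE !mulrDr [t ^+ 2 * s ^+ 2]mulrC lerD2l.
by rewrite ler_wpM2r// ler_pXn2r// ?nnegrE ltW.
Qed.

Lemma radius_sub_le : v - u <= s - t.
Proof.
have uv := radius_lt.
have : (v - u) * (v + u) <= (s - t) * (v + u).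
  have -> : (v - u) * (v + u) = (s - t) * (s + t).
    by rewrite -!subr_sqr uE vE; ring.
  by rewrite ler_wpM2l ?subr_ge0 ?(ltW ts)// lerD.
by rewrite ler_pM2r// addr_gt0.
Qed.

Lemma radius_sub_ge : (s - t) * (t / u) <= v - u.
Proof.
rewrite mulrA ler_pdivrMr//.
have : (s - t) * t * (v + u) <= (v - u) * u * (v + u).
  have -> : (v - u) * u * (v + u) = (s - t) * (s + t) * u.
    transitivity ((v ^+ 2 - u ^+ 2) * u); first by ring.
    by rewrite uE vE; ring.
  rewrite -!mulrA ler_wpM2l ?subr_ge0 ?(ltW ts)// mulrDr mulrDl lerD//.
  exact: radius_ratio.
by rewrite ler_pM2r// addr_gt0.
Qed.

(** The gap $u - t = \chi / (t + u)$ closes slowly, because [t + u] grows at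
    most proportionally to [t]. *)
Lemma radius_gap_le : (s - v) - (t - u) <= (ln s - ln t) * (chi / t).
Proof.
have utE : u - t = chi / (t + u).
  have tu0 : t + u != 0 by rewrite gt_eqF ?addr_gt0.
  apply: (mulIf tu0); rewrite divfK//.
  by transitivity (u ^+ 2 - t ^+ 2); [ring|rewrite uE; ring].
have vsE : v - s = chi / (s + v).
  have sv0 : s + v != 0 by rewrite gt_eqF ?addr_gt0.
  apply: (mulIf sv0); rewrite divfK//.
  by transitivity (v ^+ 2 - s ^+ 2); [ring|rewrite vE; ring].
have lnst : 1 - t / s <= ln s - ln t.
  have := ln_sub_le s0 t0; rewrite mulrBl divff ?gt_eqF//; lra.
apply: (@le_trans _ _ (chi / (t + u) * (1 - t / s))).
  have -> : s - v - (t - u) = chi / (t + u) - chi / (s + v).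
    by rewrite -utE -vsE; ring.
  rewrite mulrBr mulr1 lerD2l lerN2 -!mulrA ler_wpM2l//.
  rewrite -[leRHS]mul1r ler_pdivlMr ?addr_gt0//.
  have -> : (t + u)^-1 * (t / s) * (s + v) = t * (s + v) / (s * (t + u)).
    by field; apply/andP; split; rewrite gt_eqF// addr_gt0.
  rewrite ler_pdivrMr ?mulr_gt0 ?addr_gt0// mul1r !mulrDr [t * s]mulrC lerD2l.
  exact: radius_ratio.
have ts1 : 0 <= 1 - t / s by rewrite subr_ge0 ler_pdivrMr// mul1r ltW.
rewrite mulrC ler_pM//; first by rewrite divr_ge0// ltW// addr_gt0.
by rewrite ler_wpM2l// lef_pV2 ?posrE ?addr_gt0// lerDl ltW.
Qed.

(** On a logarithmic scale [u] grows almost as fast as [t]: the ratio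
    $(s^2 / t^2) / (v^2 / u^2) = (1 + \chi / t^2) / (1 + \chi / s^2)$ exceeds [1]
    by at most $(\chi / t^2) (1 - t^2 / s^2)$. *)
Lemma ln_radius_sub_ge : (ln s - ln t) * (1 - chi / t ^+ 2) <= ln v - ln u.
Proof.
have lnX2 (x : R) : 0 < x -> ln (x ^+ 2) = 2 * ln x.
  by move=> x0; rewrite lnXn// mulr_natl.
have t20 : 0 < t ^+ 2 by rewrite exprn_gt0.
have s20 : 0 < s ^+ 2 by rewrite exprn_gt0.
have v20 : 0 < v ^+ 2 by rewrite exprn_gt0.
have u20 : 0 < u ^+ 2 by rewrite exprn_gt0.
have H1 : ln ((s ^+ 2 * u ^+ 2) / (t ^+ 2 * v ^+ 2)) =
    2 * (ln s - ln t) - 2 * (ln v - ln u).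
  rewrite ln_div ?posrE ?mulr_gt0// [ln (s ^+ 2 * _)]lnM ?posrE//.
  by rewrite [ln (t ^+ 2 * _)]lnM ?posrE// !lnX2//; ring.
have H2 : 1 - t ^+ 2 / s ^+ 2 <= 2 * (ln s - ln t).
  have := ln_sub_le s20 t20; rewrite !lnX2// mulrBl divff ?gt_eqF//; lra.
have H3 := ln_le_sub1 (divr_gt0 (mulr_gt0 s20 u20) (mulr_gt0 t20 v20)).
have H4 : (s ^+ 2 * u ^+ 2) / (t ^+ 2 * v ^+ 2) - 1 <=
    (chi / t ^+ 2) * (1 - t ^+ 2 / s ^+ 2).
  have -> : (s ^+ 2 * u ^+ 2) / (t ^+ 2 * v ^+ 2) - 1 =
     (chi / t ^+ 2) * ((s ^+ 2 - t ^+ 2) / v ^+ 2).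
    rewrite uE vE; field; apply/andP; split; rewrite gt_eqF// -vE//.
  have -> : 1 - t ^+ 2 / s ^+ 2 = (s ^+ 2 - t ^+ 2) / s ^+ 2.
    by rewrite mulrBl divff// gt_eqF.
  apply: ler_wpM2l; first by rewrite divr_ge0// ltW.
  apply: ler_wpM2l.
    by rewrite subr_ge0 ler_pXn2r// ?nnegrE ltW.
  by rewrite lef_pV2 ?posrE// vE lerDl.
have H5 : (chi / t ^+ 2) * (1 - t ^+ 2 / s ^+ 2) <=
    (chi / t ^+ 2) * (2 * (ln s - ln t)).
  by apply: ler_wpM2l => //; rewrite divr_ge0// ltW.
lra.
Qed.

End radius_variation.

Section eventually_decreasing.
Context (R : realType).

(** In logarithms the increment is at most $\ln(s / t)$ times
    $\alpha - \kappa + \kappa \chi / t^2 + \varphi \chi / t$, and the last two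
    terms tend to [0]; the threshold makes them smaller than
    $\kappa - \alpha$. *)
Lemma power_radius_decreasing (chi phi alpha kappa : R) :
  0 <= chi -> 0 <= phi -> 0 <= kappa -> alpha < kappa ->
  exists2 T, 0 < T & forall t s, T < t -> t < s ->
    s `^ alpha * radius chi s `^ (- kappa) * expR (phi * (s - radius chi s)) <
    t `^ alpha * radius chi t `^ (- kappa) * expR (phi * (t - radius chi t)).
Proof.
move=> chi0 phi0 kappa0 ak.
pose T := Num.max 1 ((kappa + phi) * chi / (kappa - alpha)).
have T1 : 1 <= T by rewrite le_max lexx.
exists T => [|t s Tt ts]; first exact: lt_le_trans T1.
have t1 : 1 < t by exact: le_lt_trans Tt.
have t0 : 0 < t by exact: lt_trans t1.
have s0 : 0 < s by exact: lt_trans ts.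
have tT : (kappa + phi) * chi < (kappa - alpha) * t.
  rewrite mulrC -ltr_pdivrMl ?subr_gt0//; apply: le_lt_trans Tt.
  by rewrite mulrC le_max [X in _ || (X <= _)]mulrC lexx orbT.
rewrite !powR_expR_ln ?radius_gt0// -!expRD ltr_expR.
have q0 : 0 < ln s - ln t by rewrite subr_gt0 ltr_ln ?posrE.
have H1 := ln_radius_sub_ge chi0 t0 ts.
have H2 := radius_gap_le chi0 t0 ts.
set u := ln (radius chi t) in H1 *; set v := ln (radius chi s) in H1 *.
set g := (s - _) - _ in H2; set q := ln s - ln t in q0 H1 H2.
have H1' := ler_wpM2l kappa0 H1.
have H2' := ler_wpM2l phi0 H2.
have H3 : chi / t ^+ 2 <= chi / t.
  rewrite ler_wpM2l// lef_pV2 ?posrE ?exprn_gt0// expr2.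
  by rewrite ler_peMl// ltW.
have H4 : (kappa + phi) * (chi / t) < kappa - alpha.
  by rewrite mulrA ltr_pdivrMr.
have H5 : q * (alpha - kappa + kappa * (chi / t ^+ 2) + phi * (chi / t)) < 0.
  rewrite pmulr_rlt0//; have := ler_wpM2l kappa0 H3; lra.
rewrite -subr_lt0; apply: le_lt_trans H5.
have -> : alpha * ln s + - kappa * v + phi * (s - radius chi s) -
  (alpha * ln t + - kappa * u + phi * (t - radius chi t)) =
  alpha * q - kappa * (v - u) + phi * g by rewrite /q /g; ring.
lra.
Qed.

(** In logarithms the powers contribute at most
    $(\alpha + |\kappa|) / t$ per unit of [t], whereas the exponential loses
    nearly $\beta - \varphi$.  The threshold does not depend on [c], so
    that the estimate can be integrated over a parameter on which [c] depends. *)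
Lemma exp_radius_decreasing (chi phi beta alpha kappa : R) :
  0 <= chi -> 0 <= alpha -> 0 <= beta -> phi < beta ->
  exists2 T, 0 < T & forall t s c, T < t -> t < s -> beta <= c ->
    s `^ alpha * radius chi s `^ kappa * expR (phi * s - c * radius chi s) <
    t `^ alpha * radius chi t `^ kappa * expR (phi * t - c * radius chi t).
Proof.
move=> chi0 alpha0 beta0 pb.
pose T := Num.max 1 ((alpha + `|kappa| + beta * chi) / (beta - phi)).
have T1 : 1 <= T by rewrite le_max lexx.
exists T => [|t s c Tt ts bc]; first exact: lt_le_trans T1.
have t1 : 1 < t by exact: le_lt_trans Tt.
have t0 : 0 < t by exact: lt_trans t1.
have s0 : 0 < s by exact: lt_trans ts.
have tT : alpha + `|kappa| + beta * chi < (beta - phi) * t.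
  rewrite [ltRHS]mulrC -ltr_pdivrMr ?subr_gt0//; apply: le_lt_trans Tt.
  by rewrite le_max lexx orbT.
have u0 := radius_gt0 chi0 t0.
have v0 := radius_gt0 chi0 s0.
rewrite !powR_expR_ln// -!expRD ltr_expR.
have H1 := ln_sub_le t0 s0.
have uv := radius_lt chi0 t0 ts.
have H2 := ln_sub_le u0 v0.
have H3 := radius_sub_le chi0 t0 ts.
have H4 := radius_sub_ge chi0 t0 ts.
have H5 := radius_ge chi0 t0.
have H6 := radius_sqr t chi0.
set u := radius chi t in u0 uv H2 H3 H4 H5 H6 *.
set v := radius chi s in v0 uv H2 H3 H4 *.
have st0 : 0 < s - t by rewrite subr_gt0.
have lnuv : 0 <= ln v - ln u by rewrite subr_ge0 ler_ln ?posrE// ltW.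
have G1 : alpha * (ln s - ln t) <= alpha * ((s - t) / t) by exact: ler_wpM2l.
have G2 : kappa * (ln v - ln u) <= `|kappa| * ((s - t) / t).
  apply: (@le_trans _ _ (`|kappa| * (ln v - ln u))).
    by rewrite ler_wpM2r// ler_norm.
  rewrite ler_wpM2l//; apply: (le_trans H2).
  apply: ler_pM => //; [by rewrite subr_ge0 ltW|by rewrite invr_ge0 ltW|].
  by rewrite lef_pV2 ?posrE.
have G3 : c * (v - u) >= beta * ((s - t) * (t / u)).
  by rewrite ler_pM// mulr_ge0 ?divr_ge0 ?ltW.
(* the slope $t / u$ of the radius is close to $1$; here $u - t \le \chi / t$ *)
have G4 : 1 - chi / t <= t / u.
  rewrite ler_pdivlMr// mulrBl mul1r lerBlDr.
  have : u - t <= chi / t * u.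
    rewrite mulrAC ler_pdivlMr//.
    have : (u - t) * t <= (u - t) * (u + t).
      by rewrite ler_wpM2l ?subr_ge0//; lra.
    have -> : (u - t) * (u + t) = chi.
      by transitivity (u ^+ 2 - t ^+ 2); [ring|rewrite H6; ring].
    move=> /le_trans; apply; rewrite ler_peMr//.
    by rewrite (le_trans _ H5)// ltW.
  lra.
have G5 : alpha / t + `|kappa| / t + phi - beta * (1 - chi / t) < 0.
  have : (alpha + `|kappa| + beta * chi) / t < beta - phi.
    by rewrite ltr_pdivrMr.
  lra.
have G6 : beta * ((s - t) * (1 - chi / t)) <= beta * ((s - t) * (t / u)).
  by rewrite ler_wpM2l// ler_wpM2l// ltW.
have G7 : (s - t) * (alpha / t + `|kappa| / t + phi - beta * (1 - chi / t)) < 0.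
  by rewrite pmulr_rlt0.
rewrite -subr_lt0; apply: le_lt_trans G7.
have -> : alpha * ln s + kappa * ln v + (phi * s - c * v) -
    (alpha * ln t + kappa * ln u + (phi * t - c * u)) =
  alpha * (ln s - ln t) + kappa * (ln v - ln u) + phi * (s - t) - c * (v - u).
  by ring.
lra.
Qed.

End eventually_decreasing.

(** * Monotonicity of ratios of hyperbolic cosines *)

Section cosh_ratio.
Context (R : realType).
Implicit Types x y k a b : R.

(** Twice the hyperbolic cosine. *)
Definition dcosh x : R := expR x + expR (- x).

Lemma dcosh_gt0 x : 0 < dcosh x.
Proof. by rewrite addr_gt0 ?expR_gt0. Qed.

Lemma dcoshN x : dcosh (- x) = dcosh x.
Proof. by rewrite /dcosh opprK addrC. Qed.

Let dcoshM x y : dcosh x * dcosh y = dcosh (x + y) + dcosh (x - y).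
Proof. by rewrite /dcosh !opprD opprK !expRD; ring. Qed.

Let le_dcosh x y : `|x| <= y -> dcosh x <= dcosh y.
Proof.
rewrite ler_norml => /andP[xy yx]; rewrite -subr_ge0.
have -> : dcosh y - dcosh x =
    expR (- y) * (expR (y - x) - 1) * (expR (y + x) - 1).
  rewrite /dcosh !expRD !expRN; field.
  by rewrite !gt_eqF ?expR_gt0.
by rewrite !mulr_ge0 ?expR_ge0// subr_ge0 -[leLHS]expR0 ler_expR; lra.
Qed.

(** After cross-multiplication, $\cosh x \cosh y$ splits into
    $\cosh(x + y)$ and $\cosh(x - y)$, and the two sides compare term by term:
    $k a + b \le k b + a$ and $|k a - b| \le k b - a$. *)
Lemma dcosh_ratio_le k a b : 1 <= k -> 0 <= a -> a <= b ->
  dcosh (k * a) / dcosh a <= dcosh (k * b) / dcosh b.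
Proof.
move=> k1 a0 ab.
rewrite ler_pdivrMr ?dcosh_gt0// mulrAC ler_pdivlMr ?dcosh_gt0// !dcoshM.
have kab : 0 <= (k - 1) * (b - a) by rewrite mulr_ge0 ?subr_ge0.
have ka : 0 <= (k - 1) * (a + b).
  by rewrite mulr_ge0 ?subr_ge0// addr_ge0// (le_trans a0).
have kkab : 0 <= (k + 1) * (b - a) by rewrite mulr_ge0 ?subr_ge0//; lra.
have ka0 : 0 <= k * a by rewrite mulr_ge0//; lra.
apply: lerD; apply: le_dcosh; rewrite ler_norml; apply/andP; split; lra.
Qed.

End cosh_ratio.

(** * The integral of Bessel type *)

Section bessel_integral.
Context (R : realType).
Notation mu := (@lebesgue_measure R).
Implicit Types nu b u w : R.

Definition bessel_kernel nu b u w :=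
  w `^ (nu - 1) * expR (- (u ^+ 2 / w + b * w) / 2).

(** For $b > 0$ this is $2 (u / \sqrt b)^\nu K_\nu(u \sqrt b)$. *)
Definition bessel_integral nu b u : \bar R :=
  (\int[mu]_(w in `]0%R, +oo[) (bessel_kernel nu b u w)%:E)%E.

Lemma bessel_kernel_ge0 nu b u w : 0 <= bessel_kernel nu b u w.
Proof. by rewrite mulr_ge0 ?powR_ge0 ?expR_ge0. Qed.

Lemma measurable_bessel_kernel nu b u :
  measurable_fun [set: R] (bessel_kernel nu b u).
Proof.
apply: measurable_funM => //.
apply: measurableT_comp => //; apply: measurable_funM => //.
apply: measurableT_comp => //; apply: measurable_funD.
  by apply: measurable_funM => //; exact: measurable_invr.
exact: measurable_funM.
Qed.

Lemma ge0_integral_itv0y_scale (c : R) (f : R -> R) : 0 < c ->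
  measurable_fun [set: R] f -> (forall w, 0 <= f w) ->
  (\int[mu]_(w in `]0%R, +oo[) (f w)%:E =
   c%:E * \int[mu]_(v in `]0%R, +oo[) (f (c * v))%:E)%E.
Proof.
move=> c0 mf f0.
have mf' : measurable_fun [set: R] ((EFin \o f) \_ `]0%R, +oo[).
  apply/(measurable_restrictT _ _).1 => //.
  by apply: measurable_funTS; exact/measurable_EFinP.
rewrite integral_mkcond (ge0_integral_affine 0 c0)//; last first.
  by move=> x; apply: erestrict_ge0 => y _; rewrite lee_fin.
congr (_ * _)%E; rewrite [RHS]integral_mkcond; apply: eq_integral => v _.
by rewrite add0r /patch !mem_setE !in_itv/= !andbT pmulr_rgt0.
Qed.

(** The substitution $w = d^2 v$. *)
Lemma bessel_integral_scale nu b u d : 0 < d ->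
  (bessel_integral nu b u =
   ((d ^+ 2) `^ nu)%:E * bessel_integral nu (b * d ^+ 2) (u / d))%E.
Proof.
move=> d0; have c0 : 0 < d ^+ 2 by rewrite exprn_gt0.
rewrite {1}/bessel_integral (ge0_integral_itv0y_scale c0); last 2 first.
- exact: measurable_bessel_kernel.
- exact: bessel_kernel_ge0.
have -> : (d ^+ 2) `^ nu = d ^+ 2 * (d ^+ 2) `^ (nu - 1).
  rewrite -{2}(powRr1 (ltW c0)) -powRD; first by congr (_ `^ _); ring.
  by rewrite (gt_eqF c0) implybT.
rewrite (EFinM (d ^+ 2)) -[RHS]muleA; congr (_ * _)%E.
rewrite /bessel_integral -ge0_integralZl//.
- apply: eq_integral => v /[!inE]/=; rewrite in_itv/= andbT => v0.
  rewrite /bessel_kernel powRM ?(ltW c0) ?(ltW v0)// -EFinM -mulrA.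
  by congr (_ * (_ * expR _))%:E; field; rewrite !gt_eqF.
- apply: measurable_funTS; apply/measurable_EFinP.
  exact: measurable_bessel_kernel.
- by move=> v _; rewrite lee_fin; exact: bessel_kernel_ge0.
- by rewrite lee_fin powR_ge0.
Qed.

End bessel_integral.

Section asinh_substitution.
Context (R : realType).
Notation mu := (@lebesgue_measure R).
Implicit Types z y nu u phi : R.

(** With $D$ = [hyp z y], the numbers $(D + y) / 2$ and $(D - y) / 2$ have
    product [z] and difference [y]. *)
Definition hyp z y := Num.sqrt (y ^+ 2 + 4 * z).

Lemma hyp_sqr z y : 0 <= z -> hyp z y ^+ 2 = y ^+ 2 + 4 * z.
Proof. by move=> z0; rewrite sqr_sqrtr// addr_ge0 ?sqr_ge0// mulr_ge0. Qed.

Lemma hyp_gt0 z y : 0 < z -> 0 < hyp z y.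
Proof. by move=> z0; rewrite sqrtr_gt0 ltr_wpDl ?sqr_ge0// mulr_gt0. Qed.

Lemma hypN z y : hyp z (- y) = hyp z y.
Proof. by rewrite /hyp sqrrN. Qed.

Lemma normr_lt_hyp z y : 0 < z -> `|y| < hyp z y.
Proof.
move=> z0; rewrite -(@ltr_pXn2r _ 2)// ?nnegrE ?sqrtr_ge0//.
by rewrite hyp_sqr ?ltW// real_normK ?num_real// ltrDl mulr_gt0.
Qed.

Lemma addr_hyp_gt0 z y : 0 < z -> 0 < y + hyp z y.
Proof. by move=> /(normr_lt_hyp y); rewrite ltr_norml => /andP[? _]; lra. Qed.

Lemma addr_hyp_lt z x y : 0 < z -> x < y -> x + hyp z x < y + hyp z y.
Proof.
move=> z0 xy.
have Hx := hyp_sqr x (ltW z0); have Hy := hyp_sqr y (ltW z0).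
have := normr_lt_hyp x z0; have := normr_lt_hyp y z0.
rewrite !ltr_norml => /andP[y1 y2] /andP[x1 x2].
have H : (y - x) * (hyp z y + hyp z x + y + x) =
         (y + hyp z y - (x + hyp z x)) * (hyp z y + hyp z x).
  transitivity ((y - x) * (hyp z y + hyp z x) + (y ^+ 2 - x ^+ 2)).
    by ring.
  rewrite [RHS](_ : _ = (y - x) * (hyp z y + hyp z x) +
    (hyp z y ^+ 2 - hyp z x ^+ 2)); last by ring.
  by rewrite Hx Hy; ring.
rewrite -subr_gt0 -(@pmulr_lgt0 _ (hyp z y + hyp z x)) ?addr_gt0 ?hyp_gt0//.
by rewrite -H mulr_gt0 ?subr_gt0//; lra.
Qed.

(** This is $\operatorname{asinh}(y / (2 \sqrt z))$. *)
Definition asinh_arg z y := ln ((y + hyp z y) / Num.sqrt (4 * z)).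

Lemma expR_asinh_arg z y : 0 < z ->
  expR (asinh_arg z y) = (y + hyp z y) / Num.sqrt (4 * z).
Proof.
by move=> z0; rewrite lnK// posrE divr_gt0 ?addr_hyp_gt0// sqrtr_gt0 mulr_gt0.
Qed.

Lemma asinh_argN z y : 0 < z -> asinh_arg z (- y) = - asinh_arg z y.
Proof.
move=> z0; have s0 : 0 < Num.sqrt (4 * z) by rewrite sqrtr_gt0 mulr_gt0.
apply: expR_inj; rewrite expRN !expR_asinh_arg// hypN.
rewrite invf_div; apply: (mulIf (lt0r_neq0 s0)); rewrite divfK ?lt0r_neq0//.
have := addr_hyp_gt0 y z0; set p := y + _ => p0.
apply: (mulIf (lt0r_neq0 p0)); rewrite mulrAC divfK ?lt0r_neq0//.
rewrite -expr2 sqr_sqrtr; last by rewrite mulr_ge0 ?ltW.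
transitivity (hyp z y ^+ 2 - y ^+ 2); first by rewrite /p; ring.
by rewrite hyp_sqr ?ltW//; ring.
Qed.

Lemma dcosh_asinh_arg z y : 0 < z ->
  dcosh (asinh_arg z y) = 2 * hyp z y / Num.sqrt (4 * z).
Proof.
move=> z0; rewrite /dcosh -asinh_argN// !expR_asinh_arg// hypN -mulrDl.
by congr (_ / _); ring.
Qed.

Lemma asinh_arg_ge0 z y : 0 < z -> 0 <= y -> 0 <= asinh_arg z y.
Proof.
move=> z0 y0; apply: ln_ge0; rewrite ler_pdivlMr ?sqrtr_gt0 ?mulr_gt0// mul1r.
by rewrite (@le_trans _ _ (hyp z y)) ?lerDr// ler_sqrt ?lerDr ?sqr_ge0//
  addr_ge0 ?sqr_ge0// mulr_ge0// ltW.
Qed.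

Lemma asinh_arg_le z z' y : 0 < z -> z <= z' -> 0 <= y ->
  asinh_arg z' y <= asinh_arg z y.
Proof.
move=> z0 zz' y0; have z'0 : 0 < z' by exact: lt_le_trans zz'.
have s0 : 0 < Num.sqrt (4 * z) by rewrite sqrtr_gt0 mulr_gt0.
have s'0 : 0 < Num.sqrt (4 * z') by rewrite sqrtr_gt0 mulr_gt0.
rewrite ler_ln ?posrE ?divr_gt0 ?addr_hyp_gt0//.
rewrite 2!(mulrDl y) lerD//.
  by rewrite ler_wpM2l// lef_pV2 ?posrE// ler_wsqrtr// ler_pM2l.
have hypE (x : R) : 0 < x ->
    hyp x y / Num.sqrt (4 * x) = Num.sqrt (1 + y ^+ 2 / (4 * x)).
  move=> x0; rewrite /hyp -sqrtrV ?mulr_ge0 ?ltW// -sqrtrM; last first.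
    by rewrite addr_ge0 ?sqr_ge0// mulr_ge0 ?ltW.
  by congr Num.sqrt; field; rewrite gt_eqF.
rewrite !hypE// ler_sqrt; last first.
  by rewrite addr_ge0// divr_ge0 ?sqr_ge0// mulr_ge0// ltW.
rewrite lerD2l ler_wpM2l ?sqr_ge0// lef_pV2 ?posrE ?mulr_gt0//.
by rewrite ler_pM2l.
Qed.

Lemma measurable_asinh_arg z : measurable_fun [set: R] (asinh_arg z).
Proof.
apply: measurableT_comp => //; apply: measurable_funM => //.
apply: measurable_funD => //.
apply: (@measurableT_comp _ _ _ _ _ _ (@Num.sqrt R)).
  by apply: continuous_measurable_fun; exact: sqrt_continuous.
by apply: measurable_funD.
Qed.

(** The part of the integral of Bessel type that is left after its leading
    behaviour is factored out. *)
Definition gauss_dcosh k z : \bar R :=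
  (\int[mu]_y (expR (- (y ^+ 2 / 2)) *
      (dcosh (k * asinh_arg z y) / dcosh (asinh_arg z y)))%:E)%E.

Lemma gauss_dcoshN k z : gauss_dcosh (- k) z = gauss_dcosh k z.
Proof.
rewrite /gauss_dcosh; apply: eq_integral => y _.
by rewrite mulNr dcoshN.
Qed.

Let measurable_dcosh : measurable_fun [set: R] (@dcosh R).
Proof. by apply: measurable_funD => //; exact: measurableT_comp. Qed.

Let mdcosh_inv z :
  measurable_fun [set: R] (fun y => (dcosh (asinh_arg z y))^-1).
Proof.
apply: (@measurableT_comp _ _ _ _ _ _ (@GRing.inv R)).
  exact: measurable_invr.
apply: (@measurableT_comp _ _ _ _ _ _ (@dcosh R)) => //.
exact: measurable_asinh_arg.
Qed.

Let mgauss : measurable_fun [set: R] (fun y : R => expR (- (y ^+ 2 / 2))).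
Proof.
apply: measurableT_comp => //; apply: measurableT_comp => //.
exact: measurable_funM.
Qed.

Let mgauss_dcosh k z : measurable_fun [set: R]
  (fun y => expR (- (y ^+ 2 / 2)) *
      (dcosh (k * asinh_arg z y) / dcosh (asinh_arg z y))).
Proof.
apply: measurable_funM => //; apply: measurable_funM => //.
apply: (@measurableT_comp _ _ _ _ _ _ (@dcosh R)) => //.
by apply: measurable_funM => //; exact: measurable_asinh_arg.
Qed.

(** The integrand decreases pointwise: [asinh_arg z y] decreases in [z] for
    [y >= 0] and is odd in [y], and the ratio of cosines is even and increasing
    on the positive side. *)
Lemma gauss_dcosh_nonincreasing k z z' : 1 <= k -> 0 < z -> z <= z' ->
  (gauss_dcosh k z' <= gauss_dcosh k z)%E.
Proof.
move=> k1 z0 zz'; have z'0 : 0 < z' by exact: lt_le_trans zz'.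
have pos w y : 0 <= expR (- (y ^+ 2 / 2)) *
      (dcosh (k * asinh_arg w y) / dcosh (asinh_arg w y)).
  by rewrite mulr_ge0 ?expR_ge0// divr_ge0// ltW// dcosh_gt0.
apply: ge0_le_integral => //.
- by move=> y _; rewrite lee_fin.
- by apply/measurable_EFinP; exact: mgauss_dcosh.
- by apply/measurable_EFinP; exact: mgauss_dcosh.
move=> y _; rewrite lee_fin ler_wpM2l ?expR_ge0//.
wlog y0 : y / 0 <= y => [H|].
  have [/H//|/ltW y0] := leP 0 y.
  have := H (- y); rewrite !asinh_argN// !mulrN !dcoshN; apply.
  by rewrite oppr_ge0.
by apply: dcosh_ratio_le => //; [exact: asinh_arg_ge0|exact: asinh_arg_le].
Qed.

Lemma ge0_integral_comp_opp (f : R -> \bar R) :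
  measurable_fun [set: R] f -> (forall x, 0 <= f x)%E ->
  (\int[mu]_x f x = \int[mu]_x f (- x)%R)%E.
Proof.
move=> mf f0.
have muN (A : set R) : measurable A ->
    mu A = pushforward mu (-%R : _ -> measurableTypeR R) A.
  by move=> mA; rewrite lebesgue_measureN.
rewrite (@eq_measure_integral _ _ _ _
  (pushforward mu (-%R : _ -> measurableTypeR R))); last first.
  by move=> A mA _; exact: muN.
by rewrite ge0_integral_pushforward.
Qed.

(** The unsymmetrised integrand: the odd part of the exponential disappears when
    [y] and [- y] are added. *)
Definition gauss_expR k z y :=
  expR (- (y ^+ 2 / 2)) * (expR (k * asinh_arg z y) / dcosh (asinh_arg z y)).

Lemma gauss_expR_ge0 k z y : 0 <= gauss_expR k z y.
Proof.
by rewrite mulr_ge0 ?expR_ge0// divr_ge0 ?expR_ge0// ltW// dcosh_gt0.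
Qed.

Lemma measurable_gauss_expR k z : measurable_fun [set: R] (gauss_expR k z).
Proof.
apply: measurable_funM; first exact: mgauss.
apply: measurable_funM; last exact: mdcosh_inv.
apply: measurableT_comp => //.
by apply: measurable_funM => //; exact: measurable_asinh_arg.
Qed.

Lemma gauss_expR_sym k z y : 0 < z ->
  gauss_expR k z y + gauss_expR k z (- y) =
  expR (- (y ^+ 2 / 2)) *
    (dcosh (k * asinh_arg z y) / dcosh (asinh_arg z y)).
Proof.
move=> z0; rewrite /gauss_expR.
by rewrite asinh_argN// dcoshN mulrN sqrrN -mulrDr -mulrDl.
Qed.

Lemma gauss_dcoshE k z : 0 < z ->
  (2%:E * \int[mu]_y (gauss_expR k z y)%:E = gauss_dcosh k z)%E.
Proof.
move=> z0.
have dbl (x : \bar R) : (2%:E * x = x + x)%E by rewrite -mule2n -mule_natl.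
have m1 : measurable_fun [set: R] (EFin \o gauss_expR k z).
  by apply/measurable_EFinP; exact: measurable_gauss_expR.
have m2 : measurable_fun [set: R] ((EFin \o gauss_expR k z) \o -%R).
  apply: (@measurableT_comp _ _ _ _ _ _ (EFin \o gauss_expR k z)).
    exact: m1.
  exact: oppr_measurable.
have p1 (y : R) : (0 <= (EFin \o gauss_expR k z) y)%E.
  by rewrite lee_fin; exact: gauss_expR_ge0.
rewrite dbl; have E := ge0_integral_comp_opp m1 p1; rewrite [X in (_ + X)%E]E.
have <- := ge0_integralD mu measurableT (fun y _ => p1 y) m1
  (fun y _ => p1 (- y)) m2.
apply: eq_integral => y _; rewrite -EFinD; congr EFin.
exact: gauss_expR_sym.
Qed.

Section substitution.
Variables (nu phi u : R).
Hypotheses (phi0 : 0 < phi) (u0 : 0 < u).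
Let z := phi * u.
Let z0 : 0 < z. Proof. exact: mulr_gt0. Qed.
(* $\sqrt w$ as a function of $y = (\varphi w - u) / \sqrt w$ *)
Let q y := (y + hyp z y) / (2 * phi).
Let q0 y : 0 < q y.
Proof. by rewrite divr_gt0 ?addr_hyp_gt0// mulr_gt0. Qed.

Let is_derive_q y : is_derive y 1 (fun x => q x ^+ 2) (2 * q y ^+ 2 / hyp z y).
Proof.
have h0 : 0 < y ^+ 2 + 4 * z by rewrite ltr_wpDl ?sqr_ge0// mulr_gt0.
have H0 : hyp z y != 0 by rewrite gt_eqF// hyp_gt0.
have dhyp : is_derive y 1 (hyp z) (y / hyp z y).
  have d1 : is_derive y 1 (fun x : R => x ^+ 2 + 4 * z) (2 * y).
    by apply: is_derive_eq; rewrite /GRing.scale/=; ring.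
  have d2 := is_derive1_sqrt h0.
  have := @is_derive1_comp _ Num.sqrt (fun x : R => x ^+ 2 + 4 * z) y _ _ d2 d1.
  move=> /is_derive_eq; apply.
  by rewrite -/(hyp z y); field.
have dq : is_derive y 1 q (q y / hyp z y).
  have : is_derive y 1 (fun x => (x + hyp z x) * (2 * phi)^-1)
      ((1 + y / hyp z y) * (2 * phi)^-1).
    apply: is_derive_eq; rewrite /= scaler0 add0r.
    by rewrite /GRing.scale/= mulrC.
  move=> /is_derive_eq; apply; rewrite /q; field.
  by rewrite H0 gt_eqF.
have := is_deriveX 2 dq => /is_derive_eq; apply.
by rewrite /GRing.scale/=; field.
Qed.

Let q_lt x y : x < y -> q x < q y.
Proof. by move=> xy; rewrite ltr_pM2r ?addr_hyp_lt// invr_gt0 mulr_gt0. Qed.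

Let q_surj w : 0 < w -> exists y, q y ^+ 2 = w.
Proof.
move=> w0; have sw0 : 0 < Num.sqrt w by rewrite sqrtr_gt0.
exists ((phi * w - u) / Num.sqrt w).
have -> : q ((phi * w - u) / Num.sqrt w) = Num.sqrt w; last first.
  by rewrite sqr_sqrtr// ltW.
have H : hyp z ((phi * w - u) / Num.sqrt w) = (phi * w + u) / Num.sqrt w.
  have r0 : 0 <= (phi * w + u) / Num.sqrt w.
    by rewrite divr_ge0 ?sqrtr_ge0// addr_ge0 ?mulr_ge0// ltW.
  rewrite -(ger0_norm r0) -sqrtr_sqr /hyp; congr Num.sqrt.
  rewrite !exprMn exprVn sqr_sqrtr ?(ltW w0)//.
  by rewrite /z; field; rewrite gt_eqF.
rewrite /q H -mulrDl.
have {1}-> : phi * w = phi * Num.sqrt w ^+ 2 by rewrite sqr_sqrtr// ltW.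
rewrite [X in X / _ / _](_ : _ = 2 * phi * Num.sqrt w ^+ 2).
  by field; rewrite !gt_eqF.
by rewrite sqr_sqrtr ?(ltW w0)//; ring.
Qed.

Let kernel_q y :
  bessel_kernel nu (phi ^+ 2) u (q y ^+ 2) * (2 * q y ^+ 2 / hyp z y) =
  2 * ((u / phi) `^ nu * z `^ (- 2^-1) * expR (- z)) *
  gauss_expR (2 * nu) z y.
Proof.
have H0 : 0 < hyp z y := hyp_gt0 y z0.
have sz0 : 0 < Num.sqrt z by rewrite sqrtr_gt0.
have s4 : Num.sqrt (4 * z) = 2 * Num.sqrt z.
  rewrite sqrtrM// (_ : 4 = 2 ^+ 2) ?sqrtr_sqr ?ger0_norm//.
  by ring.
have p0 := addr_hyp_gt0 y z0.
have q20 : 0 < q y ^+ 2 by rewrite exprn_gt0.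
have E1 : (q y ^+ 2) `^ (nu - 1) * q y ^+ 2 =
    (u / phi) `^ nu * expR (2 * nu * asinh_arg z y).
  rewrite -{2}[q y ^+ 2]powRr1 ?ltW// -powRD; last first.
    by rewrite (gt_eqF q20) implybT.
  rewrite subrK mulrAC expRM -powRM ?expR_ge0//; last by rewrite divr_ge0// ltW.
  congr (_ `^ _); rewrite mulr_natl mulr2n expRD !expR_asinh_arg// s4 -expr2.
  have sz2 : Num.sqrt z ^+ 2 = phi * u by rewrite sqr_sqrtr ?(ltW z0).
  rewrite [in RHS]expr_div_n [in RHS]exprMn sz2 /q; field.
  by rewrite !gt_eqF.
have E2 : expR (- (u ^+ 2 / q y ^+ 2 + phi ^+ 2 * q y ^+ 2) / 2) =
    expR (- z) * expR (- (y ^+ 2 / 2)).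
  rewrite -expRD; congr expR.
  have -> : u ^+ 2 / q y ^+ 2 = ((hyp z y - y) / 2) ^+ 2.
    rewrite -exprVn -exprMn; congr (_ ^+ 2).
    apply: (mulIf (lt0r_neq0 (q0 y))); rewrite divfK ?lt0r_neq0//.
    rewrite /q; apply: (mulIf (lt0r_neq0 phi0)).
    transitivity ((hyp z y ^+ 2 - y ^+ 2) / 4).
      by rewrite hyp_sqr ?(ltW z0)// /z; field.
    by field; rewrite gt_eqF.
  have -> : phi ^+ 2 * q y ^+ 2 = ((y + hyp z y) / 2) ^+ 2.
    by rewrite /q; field; rewrite gt_eqF.
  transitivity (- (hyp z y ^+ 2 + y ^+ 2) / 4); first by field.
  by rewrite hyp_sqr ?(ltW z0)//; field.
rewrite /bessel_kernel /gauss_expR E2 dcosh_asinh_arg// s4 powRN.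
rewrite powR12_sqrt ?(ltW z0)//.
transitivity ((q y ^+ 2) `^ (nu - 1) * q y ^+ 2 *
  (expR (- z) * expR (- (y ^+ 2 / 2)) * 2 / hyp z y)).
  by field; rewrite gt_eqF.
by rewrite E1; field; rewrite !gt_eqF.
Qed.

(** The substitution $w = q(y)^2$ turns $u^2 / w + \varphi^2 w$ into
    $2 \varphi u + y^2$, so that the exponent no longer couples [u] with the
    variable of integration; in terms of $a$ = [asinh_arg z y] the rest is
    $e^{2 \nu a} / \cosh(a)$, of which the symmetrisation is taken. *)
Lemma bessel_integral_asinh :
  (bessel_integral nu (phi ^+ 2) u =
  ((u / phi) `^ nu * z `^ (- 2^-1) * expR (- z))%:E *
  gauss_dcosh (2 * nu) z)%E.
Proof.
have dq2 : derive1 (fun x => q x ^+ 2) = fun y => 2 * q y ^+ 2 / hyp z y.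
  by apply/funext => y; rewrite derive1E; have [_ ->] := is_derive_q y.
have hyp_cont : continuous (hyp z).
  move=> y; apply: (@continuous_comp _ _ _ (fun x : R => x ^+ 2 + 4 * z)).
    by apply: cvgD; [exact: exprn_continuous|exact: cvg_cst].
  exact: sqrt_continuous.
have q_cont : continuous q.
  move=> y; apply: cvgM; last exact: cvg_cst.
  by apply: cvgD; [exact: cvg_id|exact: hyp_cont].
rewrite /bessel_integral.
rewrite (@ge0_integration_by_substitution_itv0y _ (fun x => q x ^+ 2));
  first last.
- by move=> w _; exact: bessel_kernel_ge0.
- move=> w; rewrite in_itv/= andbT => w0; apply: cvgM.
    have dp : derivable (@powR R ^~ (nu - 1)) w 1.
      by apply: derivable_powR; rewrite in_itv/= w0.
    by move/derivable1_diffP/differentiable_continuous : dp.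
  apply: (@continuous_comp _ _ _
    (fun w : R => - (u ^+ 2 / w + phi ^+ 2 * w) / 2));
    last exact: continuous_expR.
  apply: cvgM; last exact: cvg_cst.
  apply: cvgN; apply: cvgD.
    apply: cvgM; first exact: cvg_cst.
    by apply: cvgV; [rewrite gt_eqF|exact: cvg_id].
  by apply: cvgM; [exact: cvg_cst|exact: cvg_id].
- exact: q_surj.
- by move=> y; rewrite exprn_gt0.
- rewrite dq2 => y; apply: cvgM.
    apply: cvgM; first exact: cvg_cst.
    by apply: cvgM; exact: q_cont.
  by apply: cvgV; [rewrite gt_eqF// hyp_gt0|exact: hyp_cont].
- by move=> y; have [] := is_derive_q y.
- by move=> x y xy; rewrite ltr_pXn2r ?nnegrE ?(ltW (q0 _))// q_lt.
rewrite dq2 -gauss_dcoshE// muleA -EFinM [X in X%:E]mulrC -ge0_integralZl//.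
- by apply: eq_integral => y _; rewrite -EFinM -kernel_q.
- apply/measurable_EFinP; exact: measurable_gauss_expR.
- by move=> y _; rewrite lee_fin gauss_expR_ge0.
- by rewrite lee_fin !mulr_ge0 ?powR_ge0 ?expR_ge0.
Qed.

End substitution.
End asinh_substitution.

(** * Eventual decrease of the integral of Bessel type *)

Section threshold.
Context (R : realType).
Notation mu := (@lebesgue_measure R).
Implicit Types nu b phi chi alpha t s u : R.
Local Open Scope ereal_scope.

Lemma bessel_integral_gt0 nu b u : 0 < bessel_integral nu b u.
Proof.
apply: integral_itv0y_gt0 => [|w w0].
  by apply: measurable_funTS; exact: measurable_bessel_kernel.
by rewrite mulr_gt0 ?expR_gt0 ?powR_gt0.
Qed.

(** After $w = u v$ the integrand contains
    $\exp(\varphi t - c(v) u)$ with $c(v) = (1 / v + b v) / 2 \ge \sqrt b$, and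
    [exp_radius_decreasing] applies with the same threshold to all [v]. *)
Lemma bessel_integral_decreasing_lt nu b phi chi alpha :
  (0 <= chi)%R -> (0 <= alpha)%R -> (0 <= b)%R -> (phi < Num.sqrt b)%R ->
  (forall t, (0 < t)%R -> bessel_integral nu b (radius chi t) < +oo) ->
  exists2 T, (0 < T)%R & forall t s, (T < t)%R -> (t < s)%R ->
    (s `^ alpha * expR (phi * s))%:E * bessel_integral nu b (radius chi s) <
    (t `^ alpha * expR (phi * t))%:E * bessel_integral nu b (radius chi t).
Proof.
move=> chi0 alpha0 b0 phib finI.
have [T T0 HT] := exp_radius_decreasing nu chi0 alpha0 (sqrtr_ge0 b) phib.
exists T => // t s Tt ts.
pose c v : R := ((v^-1 + b * v) / 2)%R.
have cb v : (0 < v)%R -> (Num.sqrt b <= c v)%R.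
  move=> v0; rewrite /c ler_pdivlMr// -subr_ge0.
  have -> : (v^-1 + b * v - Num.sqrt b * 2 = (1 - Num.sqrt b * v) ^+ 2 / v)%R.
    rewrite -{1}(sqr_sqrtr b0); field; exact: lt0r_neq0.
  by rewrite divr_ge0 ?sqr_ge0// ltW.
pose f t v : R := (v `^ (nu - 1) * (t `^ alpha * radius chi t `^ nu *
  expR (phi * t - c v * radius chi t)))%R.
have mf x : measurable_fun [set: R] (f x).
  apply: measurable_funM => //; apply: measurable_funM => //.
  apply: measurableT_comp => //; apply: measurable_funB => //.
  apply: measurable_funM => //; apply: measurable_funM => //.
  by apply: measurable_funD; [exact: measurable_invr|exact: measurable_funM].
have fE x : (0 < x)%R ->
    (x `^ alpha * expR (phi * x))%:E * bessel_integral nu b (radius chi x) =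
    \int[mu]_(v in `]0%R, +oo[) (f x v)%:E.
  move=> x0; have u0 := radius_gt0 chi0 x0.
  have su0 : (0 < Num.sqrt (radius chi x))%R by rewrite sqrtr_gt0.
  have suE := sqr_sqrtr (ltW u0).
  rewrite (bessel_integral_scale _ _ _ su0) suE muleA -EFinM.
  rewrite /bessel_integral -ge0_integralZl//.
  - apply: eq_integral => v /[!inE]/=; rewrite in_itv/= andbT => v0.
    rewrite -EFinM /f /bessel_kernel; congr EFin.
    have -> : (- ((radius chi x / Num.sqrt (radius chi x)) ^+ 2 / v +
      b * radius chi x * v) / 2 = - (c v * radius chi x))%R.
      rewrite expr_div_n suE /c; field; by rewrite !gt_eqF.
    by rewrite expRD; ring.
  - apply: measurable_funTS; apply/measurable_EFinP.
    exact: measurable_bessel_kernel.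
  - by move=> v _; rewrite lee_fin; exact: bessel_kernel_ge0.
  - by rewrite lee_fin !mulr_ge0 ?powR_ge0 ?expR_ge0.
have t0 : (0 < t)%R by exact: lt_trans Tt.
have s0 : (0 < s)%R by exact: lt_trans ts.
rewrite !fE//; apply: lt_integral_itv0y.
- exact: measurable_funTS.
- exact: measurable_funTS.
- by move=> v _; rewrite !mulr_ge0 ?powR_ge0 ?expR_ge0.
- move=> v v0; rewrite ltr_pM2l ?powR_gt0//.
  by apply: HT => //; exact: cb.
- rewrite -fE//; apply: lte_mul_pinfty; last exact: finI.
    by rewrite lee_fin mulr_ge0 ?powR_ge0 ?expR_ge0.
  by [].
Qed.

Lemma bessel_integral_decreasing0 nu chi alpha :
  (0 <= chi)%R -> (0 <= alpha)%R -> (alpha < - (2 * nu))%R ->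
  (forall t, (0 < t)%R -> bessel_integral nu 0 (radius chi t) < +oo) ->
  exists2 T, (0 < T)%R & forall t s, (T < t)%R -> (t < s)%R ->
    (s `^ alpha)%:E * bessel_integral nu 0 (radius chi s) <
    (t `^ alpha)%:E * bessel_integral nu 0 (radius chi t).
Proof.
move=> chi0 alpha0 alphanu finI.
have nu0 : (0 <= - (2 * nu))%R by rewrite ltW// (le_lt_trans alpha0).
have [T T0 HT] := power_radius_decreasing chi0 (lexx 0%R) nu0 alphanu.
exists T => // t s Tt ts.
have t0 : (0 < t)%R by exact: lt_trans Tt.
have s0 : (0 < s)%R by exact: lt_trans ts.
have IE x : (0 < x)%R -> bessel_integral nu 0 x =
    (x `^ (2 * nu))%:E * bessel_integral nu 0 1.
  move=> x0; rewrite (bessel_integral_scale _ _ _ x0) mul0r divff ?gt_eqF//.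
  by rewrite -powR_mulrn ?ltW// -powRrM.
have I10 := bessel_integral_gt0 nu 0 1.
have I1 : bessel_integral nu 0 1 < +oo.
  have := finI _ t0; rewrite (IE _ (radius_gt0 chi0 t0)); apply: contraTT.
  rewrite -!leNgt !leye_eq => /eqP ->.
  by rewrite gt0_muley// lte_fin powR_gt0// radius_gt0.
rewrite (IE _ (radius_gt0 chi0 s0)) (IE _ (radius_gt0 chi0 t0)) !muleA -!EFinM.
rewrite lte_pmul2r; last by [].
  by have := HT _ _ Tt ts; rewrite !mul0r expR0 !mulr1 opprK.
by rewrite ge0_fin_numE// ltW.
Qed.

(** Of the three factors of [bessel_integral_asinh], the exponential cancels
    $e^{\varphi t}$ up to $e^{\varphi (t - u)}$ and the last one is
    nonincreasing in [u]. *)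
Lemma bessel_integral_decreasing_eq nu phi chi alpha :
  (0 <= chi)%R -> (0 < phi)%R -> (0 <= alpha)%R ->
  (2 * nu <= -1)%R -> (alpha < 2^-1 - nu)%R ->
  (forall t, (0 < t)%R ->
    bessel_integral nu (phi ^+ 2) (radius chi t) < +oo) ->
  exists2 T, (0 < T)%R & forall t s, (T < t)%R -> (t < s)%R ->
    (s `^ alpha * expR (phi * s))%:E *
      bessel_integral nu (phi ^+ 2) (radius chi s) <
    (t `^ alpha * expR (phi * t))%:E *
      bessel_integral nu (phi ^+ 2) (radius chi t).
Proof.
move=> chi0 phi0 alpha0 nu1 alphanu finI.
have nu0 : (0 <= 2^-1 - nu)%R by rewrite ltW// (le_lt_trans alpha0).
have [T T0 HT] := power_radius_decreasing chi0 (ltW phi0) nu0 alphanu.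
exists T => // t s Tt ts.
have t0 : (0 < t)%R by exact: lt_trans Tt.
have s0 : (0 < s)%R by exact: lt_trans ts.
have u0 := radius_gt0 chi0 t0; have v0 := radius_gt0 chi0 s0.
pose C x : R :=
  ((x / phi) `^ nu * (phi * x) `^ (- 2^-1) * expR (- (phi * x)))%R.
have C0 x : (0 < x)%R -> (0 < C x)%R.
  by move=> x0; rewrite !mulr_gt0 ?expR_gt0 ?powR_gt0 ?divr_gt0 ?mulr_gt0.
have IE x : (0 < x)%R -> bessel_integral nu (phi ^+ 2) x =
    (C x)%:E * gauss_dcosh (2 * nu) (phi * x) by exact: bessel_integral_asinh.
have G0 x : (0 < x)%R -> 0 < gauss_dcosh (2 * nu) (phi * x).
  move=> x0; have := bessel_integral_gt0 nu (phi ^+ 2) x.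
  by rewrite IE// pmule_rgt0// lte_fin C0.
have Gfin : gauss_dcosh (2 * nu) (phi * radius chi t) \is a fin_num.
  rewrite ge0_fin_numE ?ltW ?G0//; have := finI _ t0.
  rewrite IE//; apply: contraTT; rewrite -!leNgt !leye_eq => /eqP ->.
  by rewrite gt0_muley ?lte_fin ?C0.
have CE x : (0 < x)%R -> ((x `^ alpha * expR (phi * x)) * C (radius chi x) =
  phi `^ (- nu - 2^-1) * (x `^ alpha * radius chi x `^ (- (2^-1 - nu)) *
     expR (phi * (x - radius chi x))))%R.
  move=> x0; have rx := radius_gt0 chi0 x0; rewrite /C.
  rewrite !powR_expR_ln ?divr_gt0 ?mulr_gt0// ln_div ?posrE// lnM ?posrE//.
  by rewrite -!expRD; congr expR; field.
have FE x : (0 < x)%R ->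
    (x `^ alpha * expR (phi * x))%:E *
      bessel_integral nu (phi ^+ 2) (radius chi x) =
    (x `^ alpha * expR (phi * x) * C (radius chi x))%:E *
      gauss_dcosh (2 * nu) (phi * radius chi x).
  by move=> x0; rewrite (IE _ (radius_gt0 chi0 x0)) muleA EFinM.
rewrite (FE _ s0) (FE _ t0).
apply: (@le_lt_trans _ _ ((s `^ alpha * expR (phi * s) * C (radius chi s))%:E *
    gauss_dcosh (2 * nu) (phi * radius chi t))).
  apply: lee_wpmul2l.
    by rewrite lee_fin !mulr_ge0 ?powR_ge0 ?expR_ge0// ltW// C0.
  rewrite -(opprK (2 * nu)%R) !(gauss_dcoshN (- (2 * nu))).
  apply: gauss_dcosh_nonincreasing; first by lra.
    by rewrite mulr_gt0.
  by rewrite ler_pM2l// ltW// radius_lt.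
rewrite lte_pmul2r; [|exact: Gfin|exact: (G0 _ u0)].
rewrite lte_fin (CE _ s0) (CE _ t0) ltr_pM2l; last exact: powR_gt0.
exact: HT.
Qed.

End threshold.

(** * Normal variance-mean mixtures *)

(** A real type carries two Borel structures, which have the same measurable
    sets but are different records; the identity is measurable from one to the other
    and transports integrals. *)
Lemma integral_realType (R : realType)
    (nu : {measure set (measurableTypeR R) -> \bar R}) (f : R -> \bar R) :
  measurable_fun [set: R] f -> (forall x, 0 <= f x)%E ->
  @integral _ (R : measurableType _) R nu [set: R] f =
  @integral _ (measurableTypeR R) R nu setT f.
Proof.
move=> mf f0.
pose i : measurableTypeR R -> R := fun x => x.
have mi : measurable_fun [set: measurableTypeR R] i.
  suff : measurable_fun [set: R] (fun x : R => x) by [].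
  exact: measurable_id.
have := @ge0_integral_pushforward _ _ (measurableTypeR R)
  (R : measurableType _) R i mi nu setT f measurableT mf (fun x _ => f0 x).
by rewrite preimage_setT.
Qed.

Section normal_mixture.
Context (R : realType).
Notation mu := (@lebesgue_measure R).
Implicit Types (phi w t : R) (A : set R).

(** The density at [t] of the normal law of mean [w phi] and variance [w], with
    the square in the exponent expanded. *)
Definition drift_kernel phi w t := (2 * pi * w) `^ (- 2^-1) *
  expR (phi * t - t ^+ 2 / (2 * w) - phi ^+ 2 * w / 2).

Lemma drift_kernel_ge0 phi w t : 0 <= drift_kernel phi w t.
Proof. by rewrite mulr_ge0 ?powR_ge0 ?expR_ge0. Qed.

Lemma measurable_drift_kernel phi :
  measurable_fun [set: R * R] (fun wt => drift_kernel phi wt.1 wt.2).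
Proof.
apply: measurable_funM.
  apply: (@measurableT_comp _ _ _ _ _ _ (@powR R ^~ (- 2^-1))) => //.
  by apply: measurable_funM => //; exact: measurable_fst.
apply: measurableT_comp => //; apply: measurable_funB; last first.
  by apply: measurable_funM => //; exact: measurable_funM.
apply: measurable_funB.
  by apply: measurable_funM => //; exact: measurable_snd.
apply: measurable_funM; first by apply: measurable_funX; exact: measurable_snd.
apply: (@measurableT_comp _ _ _ _ _ _ (@GRing.inv R)).
  exact: measurable_invr.
by apply: measurable_funM => //; exact: measurable_fst.
Qed.

Lemma measurable_drift_kernelr phi w :
  measurable_fun [set: R] (drift_kernel phi w).
Proof.
exact: (measurableT_comp (measurable_drift_kernel phi) (pair1_measurable w)).
Qed.

Lemma measurable_drift_kernell phi t :
  measurable_fun [set: R] (drift_kernel phi ^~ t).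
Proof.
exact: (measurableT_comp (measurable_drift_kernel phi) (pair2_measurable t)).
Qed.

Lemma drift_kernel_normal phi w z : 0 < w ->
  Num.sqrt w * drift_kernel phi w (w * phi + Num.sqrt w * z) = normal_pdf 0 1 z.
Proof.
move=> w0; rewrite normal_pdfE ?oner_eq0//.
rewrite /normal_peak /normal_fun /drift_kernel.
have pi0 := pi_gt0 R.
have sw0 : 0 < Num.sqrt w by rewrite sqrtr_gt0.
have w1 : Num.sqrt w ^+ 2 = w by rewrite sqr_sqrtr// ltW.
rewrite mulrA; congr (_ * expR _); last first.
  move: (Num.sqrt w) sw0 w1 => s s0 <-; field; exact: lt0r_neq0.
rewrite powRN powR12_sqrt; last by rewrite !mulr_ge0 ?ltW.
rewrite sqrtrM; last by rewrite mulr_ge0 ?ltW.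
rewrite expr1n mul1r -[pi *+ 2]mulr_natl invfM mulrCA divff ?mulr1//.
exact: lt0r_neq0.
Qed.

Lemma normal_prob_drift phi w A : 0 < w -> measurable A ->
  (normal_prob 0%R 1%R
     ((fun z : R => 0 + w * phi + Num.sqrt w * Num.sqrt 1 * z)%R @^-1` A)
   = \int[mu]_(t in A) (drift_kernel phi w t)%:E)%E.
Proof.
move=> w0 mA; have sw0 : 0 < Num.sqrt w by rewrite sqrtr_gt0.
have mf : measurable_fun [set: R] (EFin \o drift_kernel phi w).
  by apply/measurable_EFinP; exact: measurable_drift_kernelr.
have mfA : measurable_fun [set: R] ((EFin \o drift_kernel phi w) \_ A).
  apply/(measurable_restrictT _ _).1 => //; apply: measurable_funTS; exact: mf.
rewrite [RHS]integral_mkcond.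
rewrite (ge0_integral_affine (w * phi) sw0 mfA); last first.
  move=> t; apply: erestrict_ge0 => y _.
  by rewrite lee_fin; exact: drift_kernel_ge0.
rewrite -ge0_integralZl//.
- rewrite /normal_prob [LHS]integral_mkcond; apply: eq_integral => z _.
  rewrite /patch sqrtr1 mulr1 add0r.
  have -> : (z \in (fun z => w * phi + Num.sqrt w * z) @^-1` A) =
    (w * phi + Num.sqrt w * z \in A) by apply/idP/idP; rewrite !inE.
  case: ifPn => _; last by rewrite mule0.
  by rewrite -(drift_kernel_normal phi z w0) EFinM.
- apply: (@measurableT_comp _ _ _ _ _ _ ((EFin \o drift_kernel phi w) \_ A)).
    exact: mfA.
  by apply: measurable_funD => //; exact: measurable_funM.
- move=> t _; apply: erestrict_ge0 => y _.
  by rewrite lee_fin; exact: drift_kernel_ge0.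
Qed.

Section mixture.
Variables (phi : R) (h : R -> R).
Hypotheses (mh : measurable_fun [set: R] h) (h0 : forall w, 0 <= h w).
Hypothesis h_le0 : forall w, w <= 0 -> h w = 0.
Variable nu : {measure set (measurableTypeR R) -> \bar R}.
Hypothesis nuE : forall A, measurable A ->
  (nu A = \int[mu]_(w in A) (h w)%:E)%E.

(** Extended-valued, as the integral may be infinite at [t = 0]. *)
Definition emixture_density t : \bar R :=
  (\int[mu]_(w in `]0%R, +oo[) (drift_kernel phi w t * h w)%:E)%E.

Let mkh : measurable_fun [set: R * R]
  (fun wt : R * R => (drift_kernel phi wt.1 wt.2 * h wt.1)%:E).
Proof.
apply/measurable_EFinP; apply: measurable_funM.
  exact: measurable_drift_kernel.
by apply: measurableT_comp => //; exact: measurable_fst.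
Qed.

Let kh_ge0 w t : 0 <= drift_kernel phi w t * h w.
Proof. by rewrite mulr_ge0// drift_kernel_ge0. Qed.

Let emixture_densityE t : emixture_density t =
  (\int[mu]_w (drift_kernel phi w t * h w)%:E)%E.
Proof.
rewrite /emixture_density integral_mkcond; apply: eq_integral => w _.
rewrite /patch mem_setE in_itv/= andbT; case: ifPn => //; rewrite -leNgt.
by move=> /h_le0 ->; rewrite mulr0.
Qed.

Lemma measurable_emixture_density : measurable_fun [set: R] emixture_density.
Proof.
rewrite (_ : emixture_density =
    fun t => (\int[mu]_w (drift_kernel phi w t * h w)%:E)%E); last first.
  by apply/funext => t; exact: emixture_densityE.
apply: (@measurable_fun_fubini_tonelli_G _ _ _ _ R mu _ mkh) => -[w t].
by rewrite lee_fin.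
Qed.

(** For every value [w > 0] of the mixing variable the conditional law has
    density [drift_kernel phi w]; Tonelli exchanges the integrals in [w] and
    [t]. *)
Lemma mixture_lawE A : measurable A ->
  (pushforward ((nu : set R -> \bar R) \x normal_prob 0%R 1%R)
     (fun wz : R * R => 0 + wz.1 * phi + Num.sqrt wz.1 * Num.sqrt 1 * wz.2)%R A =
   \int[mu]_(t in A) emixture_density t)%E.
Proof.
move=> mA; rewrite /pushforward /product_measure1.
set F := fun wz : R * R => _.
have mF : measurable_fun [set: R * R] F.
  apply: measurable_funD.
    by apply: measurable_funD => //; apply: measurable_funM.
  apply: measurable_funM; last exact: measurable_snd.
  apply: measurable_funM => //.
  apply: (@measurableT_comp _ _ _ _ _ _ (@Num.sqrt R)).
    by apply: continuous_measurable_fun; exact: sqrt_continuous.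
  exact: measurable_fst.
have mFA : measurable (F @^-1` A).
  by rewrite -[X in measurable X]setTI; exact: mF.
rewrite integral_realType; last 2 first.
- exact: (measurable_fun_xsection (normal_prob 0%R 1%R) mFA).
- by move=> w; exact: measure_ge0.
rewrite (@ge0_integral_density _ (measurableTypeR R) R mu nu h mh h0 nuE);
  last 2 first.
- exact: (measurable_fun_xsection (normal_prob 0%R 1%R) mFA).
- by move=> w; exact: measure_ge0.
pose k (wt : R * R) := ((drift_kernel phi wt.1 wt.2 * h wt.1)%:E *
  (\1_A wt.2)%:E)%E.
transitivity (\int[mu]_w \int[mu]_t k (w, t))%E.
  apply: eq_integral => w _; rewrite /k /=.
  have [w0|w0] := leP w 0.
    rewrite h_le0// mule0 integral0_eq// => t _.
    by rewrite mulr0 mul0e.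
  have -> : xsection (F @^-1` A) w =
      (fun z => 0 + w * phi + Num.sqrt w * Num.sqrt 1 * z) @^-1` A.
    by apply/seteqP; split => z; rewrite /xsection /F /= inE.
  rewrite normal_prob_drift// muleC -ge0_integralZl//.
  - rewrite integral_mkcond; apply: eq_integral => t _.
    rewrite /patch indicE; case: (t \in A); last by rewrite mule0.
    by rewrite mule1 mulrC EFinM.
  - apply: measurable_funTS; apply/measurable_EFinP.
    exact: measurable_drift_kernelr.
  - by move=> t _; rewrite lee_fin; exact: drift_kernel_ge0.
  - by rewrite lee_fin.
have mk : measurable_fun [set: R * R] k.
  apply: emeasurable_funM; first exact: mkh.
  apply/measurable_EFinP.
  apply: (@measurableT_comp _ _ _ _ _ _ (\1_A : R -> R)).
    exact: measurable_indic.
  exact: measurable_snd.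
have k0 wt : (0 <= k wt)%E.
  by rewrite mule_ge0// lee_fin//; exact: kh_ge0.
rewrite (@fubini_tonelli _ _ (measurableTypeR R) (measurableTypeR R) R mu mu k
  mk k0).
rewrite [RHS]integral_mkcond; apply: eq_integral => t _.
rewrite /k /= /patch indicE; case: (t \in A); last first.
  by apply: integral0_eq => w _; rewrite mule0.
by rewrite emixture_densityE; apply: eq_integral => w _; rewrite mule1.
Qed.

End mixture.
End normal_mixture.

Section mixture_density.
Context (R : realType).
Notation mu := (@lebesgue_measure R).
Implicit Types (w t : R) (A : set R).
Variables (phi : R) (h : R -> R).
Hypotheses (mh : measurable_fun [set: R] h) (h0 : forall w, 0 <= h w).
Hypothesis h_le0 : forall w, w <= 0 -> h w = 0.
Hypothesis ih : mu.-integrable `]0, +oo[%classic (EFin \o h).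

(** With $q = (2 \pi w)^{-1/2}$ the exponent is at most
    $\varphi t - \pi (q t)^2$, and $q |t| \le 1 + \pi (q t)^2 \le
    e^{\pi (q t)^2}$. *)
Lemma drift_kernel_le w t : 0 < w -> t != 0 ->
  drift_kernel phi w t <= expR (phi * t) / `|t|.
Proof.
move=> w0 t0; have at0 : 0 < `|t| by rewrite normr_gt0.
have pi0 := pi_gt0 R.
pose q := (2 * pi * w) `^ (- 2^-1).
have q0 : 0 < q by apply: powR_gt0; rewrite !mulr_gt0.
have qE : q ^+ 2 * (2 * pi * w) = 1.
  rewrite /q powRN powR12_sqrt; last by rewrite !mulr_ge0 ?ltW.
  rewrite exprVn sqr_sqrtr ?mulVf//; last by rewrite !mulr_ge0 ?ltW.
  by rewrite gt_eqF// !mulr_gt0.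
have wE : t ^+ 2 / (2 * w) = pi * (q * `|t|) ^+ 2.
  apply: (@mulIf _ (2 * w)); first by rewrite gt_eqF// mulr_gt0.
  rewrite divfK; last by rewrite gt_eqF// mulr_gt0.
  rewrite exprMn real_normK ?num_real//.
  transitivity (t ^+ 2 * (q ^+ 2 * (2 * pi * w))); first by rewrite qE mulr1.
  by ring.
rewrite /drift_kernel -/q wE.
have H1 : expR (phi * t - pi * (q * `|t|) ^+ 2 - phi ^+ 2 * w / 2) <=
    expR (phi * t) * expR (- (pi * (q * `|t|) ^+ 2)).
  rewrite -expRD ler_expR lerBlDr lerDl.
  by rewrite divr_ge0// mulr_ge0 ?sqr_ge0// ltW.
apply: le_trans (ler_wpM2l (ltW q0) H1) _.
rewrite mulrCA ler_wpM2l ?expR_ge0// -[leRHS]div1r ler_pdivlMr// mulrAC expRN.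
rewrite ler_pdivrMr ?expR_gt0// mul1r.
apply: le_trans (expR_ge1Dx _).
set x := q * `|t|; have x0 : 0 <= x by rewrite mulr_ge0 ?ltW.
have pi2 : 2 <= pi :> R by exact: pi_ge2.
have : 2 * x ^+ 2 <= pi * x ^+ 2 by rewrite ler_wpM2r ?sqr_ge0.
have := sqr_ge0 (1 - x); have := sqr_ge0 x; nra.
Qed.

Let mker t : measurable_fun (`]0, +oo[%classic : set R)
  (fun w => drift_kernel phi w t * h w).
Proof.
apply: measurable_funTS; apply: measurable_funM => //.
exact: measurable_drift_kernell.
Qed.

Let ker_ge0 t w : 0 <= drift_kernel phi w t * h w.
Proof. by rewrite mulr_ge0// drift_kernel_ge0. Qed.

Lemma integrable_drift_kernel t : t != 0 ->
  mu.-integrable `]0, +oo[%classic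
    (EFin \o (fun w => drift_kernel phi w t * h w)).
Proof.
move=> t0.
have ig : mu.-integrable `]0, +oo[%classic
    (fun w => (expR (phi * t) / `|t|)%:E * (EFin \o h) w)%E.
  exact: integrableZl.
apply: le_integrable ig => //.
  by apply/measurable_EFinP; exact: mker.
move=> w /=; rewrite in_itv/= andbT => w0.
rewrite lee_fin (ger0_norm (ker_ge0 t w)) ger0_norm; last first.
  by rewrite mulr_ge0// divr_ge0 ?expR_ge0.
by rewrite ler_wpM2r//; exact: drift_kernel_le.
Qed.

Definition mixture_density t :=
  \int[mu]_(w in `]0, +oo[) (drift_kernel phi w t * h w).

Lemma mixture_densityE t : t != 0 ->
  (mixture_density t)%:E = emixture_density phi h t.
Proof.
move=> t0; rewrite /mixture_density /Rintegral fineK//.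
exact: (integrable_fin_num _ (integrable_drift_kernel t0)).
Qed.

Lemma mixture_density_ge0 t : 0 <= mixture_density t.
Proof. by apply: Rintegral_ge0 => w _; exact: ker_ge0. Qed.

Lemma measurable_mixture_density : measurable_fun [set: R] mixture_density.
Proof.
rewrite (_ : mixture_density = fine \o emixture_density phi h)//.
apply: (@measurableT_comp _ _ _ _ _ _ fine); first exact: fine_measurable.
exact: (measurable_emixture_density phi mh h0 h_le0).
Qed.

(** The two densities differ at most at [0], where the real-valued one takes the
    value [0] if the integral diverges. *)
Lemma integral_mixture_density A : measurable A ->
  (\int[mu]_(t in A) emixture_density phi h t =
   \int[mu]_(t in A) (mixture_density t)%:E)%E.
Proof.
move=> mA.
have mA0 : measurable (A `\ (0 : R)) by exact: measurableD.
have me : measurable_fun (A `\ (0 : R)) (emixture_density phi h).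
  apply: measurable_funTS.
  exact: (measurable_emixture_density phi mh h0 h_le0).
have mm : measurable_fun (A `\ (0 : R)) (EFin \o mixture_density).
  apply: measurable_funTS; apply/measurable_EFinP.
  exact: measurable_mixture_density.
rewrite -(integral_setD1 mA0 me) -(integral_setD1 mA0 mm).
apply: eq_integral => t /[!inE]-[_ /eqP t0].
by rewrite -mixture_densityE.
Qed.

Lemma continuous_mixture_density : {in `]0, +oo[, continuous mixture_density}.
Proof.
move=> a; rewrite in_itv/= andbT => a0.
(* on $(a / 2, 2 a)$ the kernel is dominated by a constant *)
pose C := expR (`|phi| * (2 * a)) / (a / 2).
pose I := `]a / 2, 2 * a[%classic : set R.
have tI t : I t -> [/\ 0 < t, t != 0 & expR (phi * t) / `|t| <= C].
  rewrite /I /= in_itv/= => /andP[at1 at2].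
  have t0 : 0 < t by rewrite (lt_trans _ at1)// divr_gt0.
  split=> //; first by rewrite gt_eqF.
  rewrite gtr0_norm// /C ler_pM ?expR_ge0// ?invr_ge0 ?(ltW t0)//.
    rewrite ler_expR (@le_trans _ _ (`|phi| * t))//.
      by rewrite ler_wpM2r ?(ltW t0)// ler_norm.
    by rewrite ler_wpM2l// ltW.
  by rewrite lef_pV2 ?posrE ?divr_gt0// ltW.
apply: (@continuity_under_integral R _ _ mu
  (fun t w => drift_kernel phi w t * h w) _ _ (a / 2) (2 * a) _ _
  (fun w => C * h w)).
- exact: measurable_itv.
- by move=> t /tI[_ t0 _]; exact: integrable_drift_kernel.
- apply: aeW => w _ t _.
  apply: cvgM; last exact: cvg_cst.
  apply: cvgM; first exact: cvg_cst.
  apply: (@continuous_comp _ _ _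
    (fun t : R => phi * t - t ^+ 2 / (2 * w) - phi ^+ 2 * w / 2));
    last exact: continuous_expR.
  apply: cvgB; last exact: cvg_cst.
  apply: cvgB.
    by apply: cvgM; [exact: cvg_cst|exact: cvg_id].
  by apply: cvgM; [exact: exprn_continuous|exact: cvg_cst].
- have ig : mu.-integrable `]0, +oo[%classic
      (fun w => C%:E * (EFin \o h) w)%E by exact: integrableZl.
  exact: ig.
- move=> t It; apply: aeW => w; rewrite /= in_itv/= andbT => w0.
  have [_ t0 tC] := tI _ It.
  rewrite ger0_norm; last exact: ker_ge0.
  rewrite ler_wpM2r//; apply: le_trans tC; exact: drift_kernel_le.
- by rewrite inE /I /= in_itv/=; apply/andP; split; lra.
Qed.

End mixture_density.

(** * Generalized inverse Gaussian and generalized hyperbolic laws *)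

Section gig.
Context (R : realType).
Notation mu := (@lebesgue_measure R).
Implicit Types lambda chi psi phi t w : R.

Let Rintegral_itv0y_ge0 (f : R -> R) : (forall x, 0 <= f x) ->
  0 <= \int[mu]_(x in `]0, +oo[) f x.
Proof. by move=> f0; apply: Rintegral_ge0. Qed.

Let gamma_fun_ge0 (z : R) : 0 <= gamma_fun z.
Proof.
by apply: Rintegral_itv0y_ge0 => u; rewrite mulr_ge0 ?powR_ge0 ?expR_ge0.
Qed.

Let besselK_ge0 (nu x : R) : 0 <= besselK nu x.
Proof.
rewrite mulr_ge0//; apply: Rintegral_itv0y_ge0 => u.
by rewrite mulr_ge0 ?powR_ge0 ?expR_ge0.
Qed.

Lemma gig_pdf_le0 lambda chi psi t : t <= 0 -> gig_pdf lambda chi psi t = 0.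
Proof. by rewrite /gig_pdf => ->. Qed.

(** The three forms of the density differ in their normalising constants
    only. *)
Lemma gig_pdfE lambda chi psi : exists2 c, 0 <= c & forall w, 0 < w ->
  gig_pdf lambda chi psi w =
  c * (w `^ (lambda - 1) * expR (- (chi / w + psi * w) / 2)).
Proof.
have [psi0|psi0] := eqVneq psi 0.
  exists ((chi / 2) `^ (- lambda) / gamma_fun (- lambda)).
    by rewrite divr_ge0 ?powR_ge0.
  move=> w w0; rewrite /gig_pdf leNgt w0/= psi0 eqxx mulrA.
  by congr (_ * expR _); field; rewrite gt_eqF.
have [chi0|chi0] := eqVneq chi 0.
  exists ((psi / 2) `^ lambda / gamma_fun lambda).
    by rewrite divr_ge0 ?powR_ge0.
  move=> w w0; rewrite /gig_pdf leNgt w0/= (negbTE psi0) chi0 eqxx mulrA.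
  by congr (_ * expR _); field; rewrite gt_eqF.
exists (chi `^ (- lambda) * Num.sqrt (chi * psi) `^ lambda /
    (2 * besselK lambda (Num.sqrt (chi * psi)))).
  by apply: divr_ge0; apply: mulr_ge0 => //; exact: powR_ge0.
move=> w w0; rewrite /gig_pdf leNgt w0/= (negbTE psi0) (negbTE chi0) [RHS]mulrA.
by congr (_ * expR _); field; rewrite gt_eqF.
Qed.

Lemma gig_pdf_ge0 lambda chi psi t : 0 <= gig_pdf lambda chi psi t.
Proof.
have [t0|t0] := leP t 0; first by rewrite gig_pdf_le0.
have [c c0 ->//] := gig_pdfE lambda chi psi.
by rewrite !mulr_ge0 ?powR_ge0 ?expR_ge0.
Qed.

Lemma measurable_gig_pdf lambda chi psi :
  measurable_fun [set: R] (gig_pdf lambda chi psi).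
Proof.
have [c c0 E] := gig_pdfE lambda chi psi.
pose f w := w `^ (lambda - 1) * expR (- (chi / w + psi * w) / 2).
have mf : measurable_fun [set: R] f.
  apply: measurable_funM => //.
  apply: measurableT_comp => //; apply: measurable_funM => //.
  apply: measurableT_comp => //; apply: measurable_funD.
    by apply: measurable_funM => //; exact: measurable_invr.
  exact: measurable_funM.
rewrite (_ : gig_pdf lambda chi psi = fun t => if t <= 0 then 0 else c * f t).
  have m1 : measurable_fun [set: R] (fun t : R => t <= 0).
    exact: measurable_fun_ler.
  by apply: measurable_fun_ifT => //; exact: measurable_funM.
apply/funext => t; case: ifPn => [/gig_pdf_le0//|].
by rewrite -ltNge; exact: E.
Qed.

Section gig_measure.
Variables (lambda chi psi : R).

Let gig0 : gig_law lambda chi psi set0 = 0%E.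
Proof. by rewrite /gig_law integral_set0. Qed.

Let gig_ge0 (A : set (measurableTypeR R)) : (0 <= gig_law lambda chi psi A)%E.
Proof. by apply: integral_ge0 => t _; rewrite lee_fin; exact: gig_pdf_ge0. Qed.

Let gig_sigma_additive :
  semi_sigma_additive (gig_law lambda chi psi : set (measurableTypeR R) -> _).
Proof.
move=> F mF tF mUF; rewrite /gig_law ge0_integral_bigcup//=; last 2 first.
- apply: measurable_funTS; apply/measurable_EFinP; exact: measurable_gig_pdf.
- by move=> t _; rewrite lee_fin; exact: gig_pdf_ge0.
apply: is_cvg_ereal_nneg_natsum_cond => n _ _.
by apply: integral_ge0 => t _; rewrite lee_fin; exact: gig_pdf_ge0.
Qed.

HB.instance Definition _ := isMeasure.Build _ (measurableTypeR R) _
  (gig_law lambda chi psi : set (measurableTypeR R) -> \bar R)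
  gig0 gig_ge0 gig_sigma_additive.

End gig_measure.

End gig.

Section gh.
Context (R : realType).
Notation mu := (@lebesgue_measure R).
Variables (lambda chi psi phi : R).
Hypothesis gh1 : gh_law lambda chi psi 0 1 phi [set: R] = 1%E.

Let h := gig_pdf lambda chi psi.
Let mh : measurable_fun [set: R] h.
Proof. exact: measurable_gig_pdf. Qed.
Let h0 w : 0 <= h w. Proof. exact: gig_pdf_ge0. Qed.
Let h_le0 w : w <= 0 -> h w = 0. Proof. exact: gig_pdf_le0. Qed.

Lemma gh_densityE : gh_density lambda chi psi phi = mixture_density phi h.
Proof. by []. Qed.

Lemma gh_lawE A : measurable A ->
  gh_law lambda chi psi 0 1 phi A =
  (\int[mu]_(t in A) emixture_density phi h t)%E.
Proof.
move=> mA.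
have nuE B : measurable B ->
    gig_law lambda chi psi B = (\int[mu]_(w in B) (h w)%:E)%E by [].
have := @mixture_lawE R phi h mh h0 h_le0 (gig_law lambda chi psi) nuE A mA.
by [].
Qed.

(** The normal factor is a probability, so the mixing law inherits mass one from
    the mixture. *)
Lemma integral_gig_pdf : (\int[mu]_(w in `]0%R, +oo[) (h w)%:E = 1)%E.
Proof.
rewrite -gh1 /gh_law /pushforward preimage_setT /product_measure1.
rewrite integral_realType; last 2 first.
- have mT : measurable ([set: R * measurableTypeR R]) by [].
  exact: (measurable_fun_xsection (normal_prob 0%R 1%R) mT).
- by move=> w; exact: measure_ge0.
apply/esym.
have := @integral_cst _ (measurableTypeR R) R (gig_law lambda chi psi) setT
  measurableT 1%E.
rewrite mul1e => gig_setT.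
transitivity (gig_law lambda chi psi [set: R]); last first.
  rewrite /gig_law [RHS]integral_mkcond.
  apply: eq_integral => w _; rewrite /patch mem_setE in_itv/= andbT.
  by case: ifPn => //; rewrite -leNgt => /h_le0; rewrite /h => ->.
rewrite -gig_setT; apply: eq_integral => w _ /=.
rewrite (_ : xsection _ _ = [set: _]).
  exact: (@probability_setT _ _ _ (normal_prob (0:R) 1)).
by apply/seteqP; split => z // _; rewrite /xsection/= inE.
Qed.

Let ih : mu.-integrable `]0, +oo[%classic (EFin \o h).
Proof.
apply/integrableP; split.
  by apply: measurable_funTS; apply/measurable_EFinP.
rewrite (_ : (\int[mu]_(w in _) _)%E = 1%E) ?ltry//.
rewrite -(integral_gig_pdf); apply: eq_integral => w _.
by rewrite /= ger0_norm.
Qed.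

Lemma continuous_gh_density :
  {in `]0, +oo[, continuous (gh_density lambda chi psi phi)}.
Proof. by rewrite gh_densityE; exact: continuous_mixture_density. Qed.

Lemma gh_law_density A : measurable A ->
  gh_law lambda chi psi 0 1 phi A =
  (\int[mu]_(t in A) (gh_density lambda chi psi phi t)%:E)%E.
Proof.
move=> mA; rewrite gh_lawE//.
exact: (integral_mixture_density phi mh h0 h_le0 ih mA).
Qed.

Lemma gh_density_ge0 t : 0 <= gh_density lambda chi psi phi t.
Proof. exact: mixture_density_ge0. Qed.

Lemma measurable_gh_density :
  measurable_fun [set: R] (gh_density lambda chi psi phi).
Proof. exact: (measurable_mixture_density phi mh h0 h_le0). Qed.

(** The exponent of the normal kernel adds to that of the mixing density.  The
    constant [C] is positive, since otherwise the mixing density would vanish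
    instead of having mass one. *)
Lemma gh_density_bessel : 0 <= chi -> exists2 C, 0 < C & forall t, 0 < t ->
  (gh_density lambda chi psi phi t)%:E =
  ((C * expR (phi * t))%:E *
    bessel_integral (lambda - 2^-1) (phi ^+ 2 + psi) (radius chi t))%E.
Proof.
move=> chi0; have [c c0 hE] := gig_pdfE lambda chi psi.
have {}c0 : 0 < c.
  rewrite lt_neqAle c0 andbT; apply/eqP => c0'.
  have := integral_gig_pdf; rewrite integral0_eq.
    by move=> /eqP; rewrite eq_sym onee_eq0.
  move=> w /=; rewrite in_itv/= andbT => w0.
  by rewrite /h hE// -c0' mul0r.
exists (c * (2 * pi) `^ (- 2^-1)) => [|t t0].
  by rewrite mulr_gt0// powR_gt0// mulr_gt0// pi_gt0.
have -> : (gh_density lambda chi psi phi t)%:E = emixture_density phi h t.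
  by apply: (mixture_densityE phi mh h0 ih); rewrite gt_eqF.
rewrite /emixture_density /bessel_integral -ge0_integralZl//; last 3 first.
- apply: measurable_funTS; apply/measurable_EFinP.
  exact: measurable_bessel_kernel.
- by move=> w _; rewrite lee_fin; exact: bessel_kernel_ge0.
- by rewrite lee_fin !mulr_ge0 ?expR_ge0 ?powR_ge0// ltW.
apply: eq_integral => w /[!inE]/=; rewrite in_itv/= andbT => w0.
rewrite -EFinM; congr EFin; rewrite /h hE// /drift_kernel /bessel_kernel.
rewrite radius_sqr// powRM ?mulr_ge0 ?pi_ge0 ?(ltW w0)//.
have -> : w `^ (lambda - 2^-1 - 1) = w `^ (lambda - 1) * w `^ (- 2^-1).
  rewrite -powRD; last by rewrite (gt_eqF w0) implybT.
  by congr (_ `^ _); ring.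
have -> : expR (- ((t ^+ 2 + chi) / w + (phi ^+ 2 + psi) * w) / 2) =
    expR (- (phi * t)) * expR (phi * t - t ^+ 2 / (2 * w) - phi ^+ 2 * w / 2) *
    expR (- (chi / w + psi * w) / 2).
  by rewrite -!expRD; congr expR; field; rewrite gt_eqF.
rewrite expRN; have := expR_gt0 (phi * t).
by move: (expR (phi * t)) => e e0; field; rewrite gt_eqF.
Qed.

(** The first two cases are those where $\varphi < \sqrt{\varphi^2 + \psi}$;
    in the last two, $b = \varphi^2 + \psi$ equals $\varphi^2$ with
    $\varphi > 0$, respectively [0]. *)
Lemma gh_density_threshold r :
  gig_admissible lambda chi psi -> 0 < r ->
  [\/ 0 < psi, psi = 0 /\ phi < 0, [/\ psi = 0, 0 < phi & r < - lambda] |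
      [/\ psi = 0, phi = 0, lambda < 0 & r < - 2 * lambda]] ->
  exists T, is_threshold (r + 1) (gh_density lambda chi psi phi) T.
Proof.
move=> adm r0 cases.
have [chi0 psi0] : 0 <= chi /\ 0 <= psi.
  by case: adm => [[_ /ltW ? ?]|[_ /ltW ? /ltW ?]|[_ ? /ltW ?]].
have [C C0 fE] := gh_density_bessel chi0.
have b0 : 0 <= phi ^+ 2 + psi by rewrite addr_ge0 ?sqr_ge0.
have r10 : 0 <= r + 1 by rewrite addr_ge0// ltW.
have finI t : 0 < t ->
    (bessel_integral (lambda - 2^-1) (phi ^+ 2 + psi) (radius chi t) < +oo)%E.
  move=> t0; have := ltry (gh_density lambda chi psi phi t).
  rewrite fE//; apply: contraTT; rewrite -!leNgt !leye_eq => /eqP ->.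
  by rewrite gt0_muley// lte_fin mulr_gt0 ?expR_gt0.
have key T : 0 < T -> (forall t s, (T < t)%R -> (t < s)%R ->
    (s `^ (r + 1) * expR (phi * s))%:E *
      bessel_integral (lambda - 2^-1) (phi ^+ 2 + psi) (radius chi s) <
    (t `^ (r + 1) * expR (phi * t))%:E *
      bessel_integral (lambda - 2^-1) (phi ^+ 2 + psi) (radius chi t))%E ->
    is_threshold (r + 1) (gh_density lambda chi psi phi) T.
  move=> T0 H; split=> // s t Ts st.
  have s0 : 0 < s by exact: lt_trans Ts.
  have t0 : 0 < t by exact: lt_trans st.
  have E x : 0 < x -> (x `^ (r + 1) * gh_density lambda chi psi phi x)%:E =
      (C%:E * ((x `^ (r + 1) * expR (phi * x))%:E *
       bessel_integral (lambda - 2^-1) (phi ^+ 2 + psi) (radius chi x)))%E.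
    move=> x0; rewrite EFinM fE// !muleA -!EFinM.
    by congr (_%:E * _)%E; ring.
  rewrite -lte_fin (E _ s0) (E _ t0) lte_pmul2l; [exact: H|by []|].
  by rewrite lte_fin.
have sqrtb : 0 < psi \/ psi = 0 /\ phi < 0 -> phi < Num.sqrt (phi ^+ 2 + psi).
  move=> [psi_gt0|[-> phi_lt0]].
    apply: (@le_lt_trans _ _ `|phi|); first exact: ler_norm.
    by rewrite -sqrtr_sqr ltr_sqrt ?ltrDl// ltr_wpDl ?sqr_ge0.
  by rewrite addr0 sqrtr_sqr ltr0_norm// (lt_trans phi_lt0)// oppr_gt0.
have phib_case : phi < Num.sqrt (phi ^+ 2 + psi) ->
    exists T, is_threshold (r + 1) (gh_density lambda chi psi phi) T.
  move=> phib.
  have [T T0 HT] := bessel_integral_decreasing_lt chi0 r10 b0 phib finI.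
  by exists T; exact: key.
case: cases => [psi_gt0|[psiE phi_lt0]|[psiE phi_gt0 rl]|[psiE phiE l0 rl]].
- by apply: phib_case; apply: sqrtb; left.
- by apply: phib_case; apply: sqrtb; right.
- rewrite psiE addr0 in finI key *.
  have nu1 : 2 * (lambda - 2^-1) <= -1 by lra.
  have nu2 : r + 1 < 2^-1 - (lambda - 2^-1) by lra.
  have [T T0 HT] := bessel_integral_decreasing_eq chi0 phi_gt0 r10 nu1 nu2 finI.
  by exists T; exact: key.
- have nu2 : r + 1 < - (2 * (lambda - 2^-1)) by lra.
  have b0' : phi ^+ 2 + psi = 0 by rewrite psiE phiE expr0n/= addr0.
  rewrite b0' in finI key.
  have [T T0 HT] := bessel_integral_decreasing0 chi0 r10 nu2 finI.
  exists T; apply: key => // t s Tt ts.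
  by rewrite phiE !mul0r expR0 !mulr1; exact: HT.
Qed.

End gh.

(** * Concavity of distribution functions along power means *)

Section power_mean.
Context (R : realType).
Notation mu := (@lebesgue_measure R).
Implicit Types (a b r l x y : R).

Lemma ler_powRN r x y : 0 < r -> 0 < x -> 0 < y ->
  (y `^ (- r) <= x `^ (- r)) = (x <= y).
Proof.
move=> r0 x0 y0; rewrite !powR_expR_ln// ler_expR !mulNr lerN2 ler_pM2l//.
by rewrite ler_ln ?posrE.
Qed.

Lemma integral_powR_itvoc a b r : 0 < r -> 0 < a -> a <= b ->
  (\int[mu]_(s in `]a, b]) (s `^ (- (r + 1)))%:E =
   ((a `^ (- r) - b `^ (- r)) / r)%:E)%E.
Proof.
move=> r0 a0; rewrite le_eqVlt => /predU1P[<-|ab].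
  by rewrite set_itv_ge ?bnd_simp// integral_set0 subrr mul0r.
have cpow (k s : R) : 0 < s -> {for s, continuous (fun x : R => x `^ k)}.
  move=> s0; have dp : derivable (@powR R ^~ k) s 1.
    by apply: derivable_powR; rewrite in_itv/= s0.
  by move/derivable1_diffP/differentiable_continuous : dp.
pose F s := - (s `^ (- r) / r).
have dF (s : R) : 0 < s -> is_derive s 1 F (s `^ (- (r + 1))).
  move=> s0; have d1 := is_derive1_powR (- r) s0.
  have : is_derive s 1 (fun x => - (x `^ (- r) * r^-1))
      (- (- r * s `^ (- r - 1) * r^-1)).
    apply: is_derive_eq; rewrite scaler0 add0r.
    by rewrite /GRing.scale/= [in LHS]mulrC.
  move=> /is_derive_eq; apply; rewrite opprD.
  by field; rewrite gt_eqF.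
have cF (s : R) : 0 < s -> {for s, continuous F}.
  move=> s0; have dp : derivable F s 1 by have [] := dF _ s0.
  by move/derivable1_diffP/differentiable_continuous : dp.
rewrite integral_itv_obnd_cbnd; last first.
  by apply: measurable_funTS; apply/measurable_EFinP; exact: measurable_powR.
rewrite (@continuous_FTC2 _ _ F)//.
- by rewrite -EFinB; congr EFin; rewrite /F; ring.
- apply: continuous_in_subspaceT => s /[!inE]/=; rewrite in_itv/=.
  by move=> /andP[sa _]; apply: cpow; exact: lt_le_trans sa.
- split.
  + move=> s; rewrite in_itv/= => /andP[sa _].
    by have [] := dF _ (lt_trans a0 sa).
  + by apply: cvg_at_right_filter; exact: cF.
  + by apply: cvg_at_left_filter; apply: cF; exact: lt_trans ab.
- move=> s; rewrite in_itv/= => /andP[sa _].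
  by rewrite derive1E; have [_ ->] := dF _ (lt_trans a0 sa).
Qed.

End power_mean.

Section cdf_concave.
Context (R : realType) d (T : measurableType d) (P : probability T R).
Notation mu := (@lebesgue_measure R).
Variables (X : {RV P >-> R}) (f : R -> R) (r tstar : R).
Hypotheses (Xf : has_density X f) (r0 : 0 < r).
Hypothesis thr : is_threshold (r + 1) f tstar.
Implicit Types a b c l : R.

Let mf : measurable_fun [set: R] f. Proof. by have [] := Xf. Qed.
Let f0 t : 0 <= f t. Proof. by have [] := Xf. Qed.
Let lawX A : measurable A ->
  distribution P X A = (\int[mu]_(t in A) (f t)%:E)%E.
Proof. by have [_ _] := Xf; apply. Qed.
Let tstar0 : 0 < tstar. Proof. by have [] := thr. Qed.

Let F t := fine (cdf X t).

Let FE t : (F t)%:E = cdf X t.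
Proof. by rewrite fineK// fin_num_measure. Qed.

Let F_sub a b : a <= b ->
  ((F b - F a)%:E = \int[mu]_(t in `]a, b]) (f t)%:E)%E.
Proof.
move=> ab; rewrite EFinB !FE /cdf.
have -> : `]-oo, b]%classic = `]-oo, a]%classic `|` `]a, b]%classic.
  by rewrite -itv_bndbnd_setU// bnd_simp.
rewrite measureU//.
  by rewrite addeAC subee ?add0e ?fin_num_measure//; exact: lawX.
rewrite -subset0 => t [] /=; rewrite !in_itv/= => ta /andP[at' _].
by move: (le_lt_trans ta at'); rewrite ltxx.
Qed.

Let h s := s `^ (r + 1) * f s.

Let h_le a b : tstar < a -> a <= b -> h b <= h a.
Proof.
move=> ta; rewrite le_eqVlt => /predU1P[->//|ab].
by have [_ /(_ a b ta ab)/ltW] := thr.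
Qed.

Let f_h s : 0 < s -> f s = h s * s `^ (- (r + 1)).
Proof.
by move=> s0; rewrite powRN mulrAC divff ?mul1r// gt_eqF// powR_gt0.
Qed.

Let mpow a b : measurable_fun (`]a, b]%classic : set R)
  (fun s => (s `^ (- (r + 1)))%:E).
Proof.
by apply: measurable_funTS; apply/measurable_EFinP; exact: measurable_powR.
Qed.

Let integral_h a b c : 0 < a -> a <= b -> 0 <= c ->
  (\int[mu]_(s in `]a, b]) (c * s `^ (- (r + 1)))%:E =
   (c * ((a `^ (- r) - b `^ (- r)) / r))%:E)%E.
Proof.
move=> a0 ab c0; rewrite EFinM -integral_powR_itvoc// -ge0_integralZl//.
- exact: mpow.
- by move=> s _; rewrite lee_fin powR_ge0.
Qed.

(** On the interval, $f(s) = (s^{r + 1} f(s)) s^{- r - 1}$, and the first factor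
    is at least its value at the right end point [b]. *)
Lemma cdf_sub_ge a b : tstar < a -> a <= b ->
  h b * ((a `^ (- r) - b `^ (- r)) / r) <= F b - F a.
Proof.
move=> ta ab; have a0 : 0 < a by exact: lt_trans ta.
rewrite -lee_fin F_sub// -integral_h//; last first.
  by rewrite mulr_ge0 ?powR_ge0.
apply: ge0_le_integral => //.
- by move=> s _; rewrite lee_fin !mulr_ge0 ?powR_ge0.
- apply: measurable_funTS; apply/measurable_EFinP.
  by apply: measurable_funM => //; exact: measurable_powR.
- by apply: measurable_funTS; apply/measurable_EFinP.
move=> s /=; rewrite in_itv/= => /andP[sa sb].
rewrite lee_fin [leRHS]f_h ?(lt_trans a0)// ler_wpM2r ?powR_ge0//.
by apply: h_le => //; exact: lt_trans sa.
Qed.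

Lemma cdf_sub_le a b : tstar < a -> a <= b ->
  F b - F a <= h a * ((a `^ (- r) - b `^ (- r)) / r).
Proof.
move=> ta ab; have a0 : 0 < a by exact: lt_trans ta.
rewrite -lee_fin F_sub// -integral_h//; last first.
  by rewrite mulr_ge0 ?powR_ge0.
apply: ge0_le_integral => //.
- by move=> s _; rewrite lee_fin.
- by apply: measurable_funTS; apply/measurable_EFinP.
- apply: measurable_funTS; apply/measurable_EFinP.
  by apply: measurable_funM => //; exact: measurable_powR.
move=> s /=; rewrite in_itv/= => /andP[sa sb].
rewrite lee_fin [leLHS]f_h ?(lt_trans a0)// ler_wpM2r ?powR_ge0//.
by apply: h_le => //; exact: ltW.
Qed.

Let cdf_concave_le a b l : tstar < a -> a <= b -> 0 <= l <= 1 ->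
  l * F a + (1 - l) * F b <= F (mean_alpha (- r)%:E a b l).
Proof.
move=> ta ab /andP[l0 l1].
have a0 : 0 < a by exact: lt_trans ta.
have b0 : 0 < b by exact: lt_le_trans ab.
rewrite /mean_alpha mulf_eq0 (gt_eqF a0) (gt_eqF b0)/= oppr_eq0 (gt_eqF r0).
set M := l * a `^ (- r) + _; set c := M `^ _.
have ba : b `^ (- r) <= a `^ (- r) by rewrite ler_powRN.
have bM : b `^ (- r) <= M by rewrite /M; nra.
have Ma : M <= a `^ (- r) by rewrite /M; nra.
have M0 : 0 < M by apply: lt_le_trans bM; exact: powR_gt0.
have c0 : 0 < c by exact: powR_gt0.
have cM : c `^ (- r) = M.
  by rewrite /c -powRrM mulVf ?powRr1 ?(ltW M0)// oppr_eq0 gt_eqF.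
have ac : a <= c by rewrite -(ler_powRN r0)// cM.
have cb : c <= b by rewrite -(ler_powRN r0)// cM.
have H1 := cdf_sub_ge ta ac.
have H2 := cdf_sub_le (lt_le_trans ta ac) cb.
rewrite cM in H1 H2.
have H1' := ler_wpM2l l0 H1.
have l1' : 0 <= 1 - l by rewrite subr_ge0.
have H2' := ler_wpM2l l1' H2.
have E : l * (h c * ((a `^ (- r) - M) / r)) =
    (1 - l) * (h c * ((M - b `^ (- r)) / r)).
  by rewrite /M; field; rewrite gt_eqF.
lra.
Qed.

(** By symmetry let $a \le b$.  At the mean $c$ of exponent $- r$, the increments of the
    distribution function from $a$ to $c$ and from $c$ to $b$ are at least,
    respectively at most, $c^{r + 1} f(c) / r$ times the decrements of
    $s^{- r}$, and $c^{- r}$ divides $[b^{- r}, a^{- r}]$ in the ratio given by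
    the weights. *)
Lemma cdf_concave a b l : tstar < a -> tstar < b -> 0 <= l <= 1 ->
  l * fine (cdf X a) + (1 - l) * fine (cdf X b) <=
  fine (cdf X (mean_alpha (- r)%:E a b l)).
Proof.
move=> ta tb l01; have [ab|/ltW ba] := leP a b; first exact: cdf_concave_le.
have l01' : 0 <= 1 - l <= 1 by move: l01; lra.
have := cdf_concave_le tb ba l01'; rewrite /F.
have -> : mean_alpha (- r)%:E b a (1 - l) = mean_alpha (- r)%:E a b l.
  rewrite /mean_alpha !mulf_eq0 (gt_eqF (lt_trans tstar0 ta)).
  by rewrite (gt_eqF (lt_trans tstar0 tb)) /= oppr_eq0 (gt_eqF r0) subKr addrC.
by rewrite subKr addrC.
Qed.

End cdf_concave.

(** * Products of averages and convexity of the probability set *)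

Section product.
Context (R : realType).

(** By convexity of the exponential, every average is at least the weighted
    geometric mean, and geometric means commute with products. *)
Lemma prod_conv_ge m (x y : 'I_m -> R) (l p : R) : 0 <= l <= 1 -> 0 < p ->
  (forall i, 0 < x i) -> (forall i, 0 < y i) ->
  p <= \prod_(i < m) x i -> p <= \prod_(i < m) y i ->
  p <= \prod_(i < m) (l * x i + (1 - l) * y i).
Proof.
move=> /andP[l0 l1] p0 x0 y0 px py.
have prodE (z : 'I_m -> R) : (forall i, 0 < z i) ->
    \prod_(i < m) z i = expR (\sum_(i < m) ln (z i)).
  by move=> z0; rewrite expR_sum; apply: eq_bigr => i _; rewrite lnK ?posrE.
have conv_exp i : expR (l * ln (x i) + (1 - l) * ln (y i)) <=
    l * x i + (1 - l) * y i.
  set k := _ + _; rewrite -{1}[x i]lnK ?posrE// -{1}[y i]lnK ?posrE//.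
  (* the tangent to the exponential at [k] *)
  have tangent (a : R) : expR k * (1 + (a - k)) <= expR a.
    rewrite -[in leRHS](subrKC k a) [leRHS]expRD ler_wpM2l ?expR_ge0//.
    exact: expR_ge1Dx.
  have Tx := ler_wpM2l l0 (tangent (ln (x i))).
  have l1' : 0 <= 1 - l by rewrite subr_ge0.
  have Ty := ler_wpM2l l1' (tangent (ln (y i))).
  have : l * (expR k * (1 + (ln (x i) - k))) +
      (1 - l) * (expR k * (1 + (ln (y i) - k))) = expR k by rewrite /k; ring.
  lra.
apply: (@le_trans _ _ (\prod_(i < m) expR (l * ln (x i) + (1 - l) * ln (y i)))).
  rewrite -expR_sum big_split/= -!mulr_sumr.
  rewrite -[leLHS]lnK ?posrE// ler_expR.
  rewrite !prodE// in px py.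
  have lpx : ln p <= \sum_(i < m) ln (x i).
    by rewrite -ler_expR lnK ?posrE.
  have lpy : ln p <= \sum_(i < m) ln (y i).
    by rewrite -ler_expR lnK ?posrE.
  nra.
by apply: ler_prod => i _; rewrite expR_ge0 conv_exp.
Qed.

Lemma prod_le_factor m (x : 'I_m -> R) (i : 'I_m) :
  (forall j, 0 <= x j <= 1) -> \prod_(j < m) x j <= x i.
Proof.
move=> x01; rewrite (bigD1 i)//= ler_piMr//; first by have /andP[] := x01 i.
apply: (@le_trans _ _ (\prod_(j < m | j != i) 1)); last by rewrite big1_eq.
by apply: ler_prod => j _; exact: x01.
Qed.

End product.

Section prob_set_convex.
Context (R : realType) d (T : measurableType d) (P : probability T R).

(** Since all factors are at most [1], each of them is at least the product,
    hence at least [p]: this is what puts every [g i x] beyond the threshold and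
    makes [cdf_concave] available. *)
Lemma convex_prob_set (m N : nat) (xi : 'I_m -> {RV P >-> R})
  (f : 'I_m -> R -> R) (r : 'I_m -> R) (tstar : 'I_m -> R)
  (X : set 'rV[R]_N) (g : 'I_m -> 'rV[R]_N -> R) (p : R) :
  (0 < m)%N -> (forall i, has_density (xi i) (f i)) -> (forall i, 0 < r i) ->
  (forall i, is_threshold (r i + 1) (f i) (tstar i)) ->
  convex_set X -> (forall i, alpha_concave (- r i)%:E X (g i)) ->
  (\big[maxe/-oo]_(i < m) cdf (xi i) (tstar i) < p%:E)%E ->
  convex_set (prob_set X xi g p).
Proof.
move=> m0 xif r0 thr cX gconc tp.
have tp' i : (cdf (xi i) (tstar i) < p%:E)%E.
  by apply: le_lt_trans tp; exact: le_bigmax.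
have p0 : 0 < p.
  have := tp' (Ordinal m0); rewrite -lte_fin.
  exact: le_lt_trans (cdf_ge0 _ _).
pose G i t := fine (cdf (xi i) t).
have GE i t : cdf (xi i) t = (G i t)%:E by rewrite fineK// fin_num_measure.
have G01 i t : 0 <= G i t <= 1.
  by rewrite -!lee_fin -GE cdf_ge0 cdf_le1.
have setE x : prob_set X xi g p x <-> X x /\ p <= \prod_(i < m) G i (g i x).
  rewrite /prob_set/=.
  have -> : (\prod_(i < m) P [set w | (xi i w <= g i x)%R])%E =
      (\prod_(i < m) G i (g i x))%:E.
    rewrite -prodEFin; apply: eq_bigr => i _; rewrite -GE /cdf /distribution.
    by rewrite /pushforward; congr (P _); apply/seteqP; split => w /=;
      rewrite in_itv.
  by rewrite lee_fin.
have gt x i : p <= \prod_(i < m) G i (g i x) -> tstar i < g i x.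
  move=> px; rewrite ltNge; apply/negP => gx.
  have := tp' i; rewrite ltNge => /negP; apply.
  apply: le_trans (cdf_nondecreasing _ gx); rewrite GE lee_fin.
  by apply: (le_trans px); exact: (prod_le_factor i (fun j => G01 j (g j x))).
have pos x i : p <= \prod_(i < m) G i (g i x) -> 0 < G i (g i x).
  move=> px; apply: (lt_le_trans p0); apply: (le_trans px).
  exact: (prod_le_factor i (fun j => G01 j (g j x))).
move=> x y l; rewrite !inE => /setE[Xx px] /setE[Xy py]; apply/setE; split.
  by have := cX x y l; rewrite !inE; apply.
have l01 : 0 <= l%:num <= 1 by apply/andP; split.
apply: (le_trans (prod_conv_ge l01 p0 _ _ px py)).
- by move=> i; exact: pos.
- by move=> i; exact: pos.
apply: ler_prod => i _; apply/andP; split.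
  have /andP[a0 _] := G01 i (g i x); have /andP[b0 _] := G01 i (g i y).
  by case/andP: l01 => l0 l1; rewrite addr_ge0// mulr_ge0// subr_ge0.
apply: (le_trans (cdf_concave (xif i) (r0 i) (thr i) (gt _ i px) (gt _ i py)
  l01)).
rewrite -lee_fin !fineK ?fin_num_measure//; apply: cdf_nondecreasing.
have [_ /(_ x y l%:num Xx Xy l01)] := gconc i.
by [].
Qed.

End prob_set_convex.

(** * Convexity of constraints with generalized hyperbolic variables *)

Theorem theorem7 (R : realType) (m N : nat) (hm : (1 <= m)%N) (hN : (1 <= N)%N)
  (d : measure_display) (T : measurableType d) (P : probability T R)
  (lambda chi psi phi r : 'I_m -> R)
  (xi : 'I_m -> {RV P >-> R})
  (hadm : forall i, gig_admissible (lambda i) (chi i) (psi i))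
  (hxi : forall i,
     has_law (xi i) (gh_law (lambda i) (chi i) (psi i) 0 1 (phi i)))
  (hind : mutually_independent xi)
  (hr : forall i, 0 < r i)
  (hcase : forall i,
     [\/ 0 < psi i,
         psi i = 0 /\ phi i < 0,
         [/\ psi i = 0, 0 < phi i & r i < - lambda i] |
         [/\ psi i = 0, phi i = 0, lambda i < 0 & r i < - 2 * lambda i]])
  (X : set 'rV[R]_N) (hX : convex_set X)
  (g : 'I_m -> 'rV[R]_N -> R)
  (hg : forall i, alpha_concave (- r i)%:E X (g i)) :
  let f i := gh_density (lambda i) (chi i) (psi i) (phi i) in
  (forall i, has_density (xi i) (f i) /\ alpha_decreasing (r i + 1) (f i)) /\
  (forall tstar : 'I_m -> R,
     (forall i, is_threshold (r i + 1) (f i) (tstar i)) ->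
     forall p : R,
       (\big[maxe/-oo]_(i < m) cdf (xi i) (tstar i) < p%:E)%E ->
       convex_set (prob_set X xi g p)).
Proof.
move=> f.
have hd i : has_density (xi i) (f i) /\
    gh_law (lambda i) (chi i) (psi i) 0 1 (phi i) [set: R] = 1%E.
  have gh1 : gh_law (lambda i) (chi i) (psi i) 0 1 (phi i) [set: R] = 1%E.
    by rewrite -hxi//; exact: probability_setT.
  split=> //; split.
  - exact: measurable_gh_density.
  - exact: gh_density_ge0.
  - by move=> A mA; rewrite hxi//; exact: gh_law_density.
split=> [i|tstar thr p tp].
  have [dens gh1] := hd i; split=> //; split.
    exact: continuous_gh_density.
  exact: gh_density_threshold.
exact: (convex_prob_set hm (fun i => (hd i).1) hr thr hX hg tp).
Qed.
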